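(* Let $G$ be a simply connected (in particular connected) Lie group with a bi-invariant pseudo-Riemannian metric, corresponding to the $\mathrm{Ad}$-invariant non-degenerate symmetric bilinear form $B$ on $\mathfrak{g}$. Let $\psi\in\Omega(G)$ be the smooth $\mathrm{Ad}$-invariant differential form satisfying $$\psi_g={\det}^{1/2}\Big(\tfrac{\mathrm{Ad}_g+1}{2}\Big)\,\exp\Big(\tfrac14 B\big(\tfrac{1-\mathrm{Ad}_g}{1+\mathrm{Ad}_g}\theta^L,\theta^L\big)\Big)$$ at all $g\in G$ for which $\mathrm{Ad}_g+1$ is invertible. Let $\mathcal{C}\subset G$ be a conjugacy class, with inclusion $\iota_{\mathcal{C}}\colon\mathcal{C}\hookrightarrow G$ and with Guruprasad–Huebschmann–Jeffrey–Weinstein (GHJW) 2-form $\omega\in\Omega^2(\mathcal{C})$. Then the top degree part of the differential form $e^{\omega}\,\iota_{\mathcal{C}}^*\psi$ is a volume form on $\mathcal{C}$ (i.e. it is nowhere vanishing).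
   Context: $\theta^L\in\Omega^1(G)\otimes\mathfrak{g}$ is the left-invariant Maurer–Cartan form. For a $B$-skew-adjoint $D\in\mathrm{End}(\mathfrak g)$, $B(D\theta^L,\theta^L)(X,Y)=B(D\theta^L(X),\theta^L(Y))-B(D\theta^L(Y),\theta^L(X))$; exponentials are taken in the exterior algebra. The sign of the real square root ${\det}^{1/2}$ at each $g$ is the one for which $\psi$ is smooth on $G$, normalized so that $\psi_e=1$; such a $\psi$ exists and is well-defined. A conjugacy class is an orbit of the conjugation action $a\mapsto gag^{-1}$. For $\xi\in\mathfrak g$ let $\xi^L,\xi^R$ be the corresponding left-, right-invariant vector fields on $G$, and $\xi^\sharp=\xi^L-\xi^R$ the generating vector field of the conjugation action, which is tangent to $\mathcal C$. The GHJW 2-form on $\mathcal{C}$ is the well-defined $\mathrm{Ad}$-invariant 2-form with $$\omega(\xi_1^\sharp,\xi_2^\sharp)\big|_g=-B\Big(\tfrac{\mathrm{Ad}_g-\mathrm{Ad}_{g^{-1}}}{2}\xi_1,\xi_2\Big),\quad g\in\mathcal{C};$$ equivalently, $\iota(\xi^\sharp)\omega=\iota_{\mathcal C}^*B\big(\tfrac{\theta^L+\theta^R}{2},\xi\big)$ for all $\xi\in\mathfrak g$, where $\theta^R$ is the right-invariant Maurer–Cartan form and $\iota(v)\omega=\omega(v,\cdot)$. *)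

(* Defs.v *)
From HB Require Import structures.
From mathcomp Require Import all_boot all_order all_algebra.
From mathcomp Require Import all_classical all_reals all_analysis.

Set Implicit Arguments.
Unset Strict Implicit.
Unset Printing Implicit Defensive.

Import Order.TTheory GRing.Theory Num.Theory.
Import numFieldNormedType.Exports.

Local Open Scope classical_set_scope.
Local Open Scope ring_scope.

(* C^k and smooth maps on open subsets of normed spaces.  For finite-dimensional
   V, being C^k.+1 amounts to being differentiable with all directional
   derivatives of class C^k. *)
Fixpoint Ck_on (R : realType) (V W : normedModType R) (k : nat) (U : set V)
    (f : V -> W) : Prop :=
  if k is k'.+1 then
    (forall x, U x -> differentiable f x) /\ (forall v, Ck_on k' U ('D_v f))
  else forall x, U x -> {for x, continuous f}.

Definition smooth_on (R : realType) (V W : normedModType R) (U : set V)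
    (f : V -> W) : Prop :=
  forall k, Ck_on k U f.

Record chart (R : realType) (M : topologicalType) (n : nat) := Chart {
  source : set M;
  target : set 'rV[R]_n;
  coord :> M -> 'rV[R]_n;
  coord_inv : 'rV[R]_n -> M;
  open_source : open source;
  open_target : open target;
  coord_target : forall p, source p -> target (coord p);
  coord_inv_source : forall x, target x -> source (coord_inv x);
  coordK : forall p, source p -> coord_inv (coord p) = p;
  coord_invK : forall x, target x -> coord (coord_inv x) = x;
  coord_continuous : forall p, source p -> {for p, continuous coord};
  coord_inv_continuous : forall x, target x -> {for x, continuous coord_inv}
}.

(* A smooth n-manifold structure on the space M.  The preferred chart at each
   point serves to represent tangent vectors, see [tangent_map]. *)
Record manifold (R : realType) (M : topologicalType) (n : nat) := Manifold {
  atlas : set (chart R M n);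
  chart_at : M -> chart R M n;
  chart_at_atlas : forall p, atlas (chart_at p);
  chart_at_source : forall p, source (chart_at p) p;
  atlas_compat : forall c c', atlas c -> atlas c' ->
    smooth_on (target c `&` coord_inv c @^-1` source c') (c' \o coord_inv c);
  manifold_hausdorff : hausdorff_space M;
  manifold_second_countable : @second_countable M
}.

Section Manifolds.
Variable R : realType.

Definition smooth_map (M N : topologicalType) (m n : nat)
    (SM : manifold R M m) (SN : manifold R N n) (f : M -> N) : Prop :=
  continuous f /\
  forall c c', atlas SM c -> atlas SN c' ->
    smooth_on (target c `&` coord_inv c @^-1` (f @^-1` source c'))
      (c' \o f \o coord_inv c).

(* The tangent space at p is 'rV_m, a tangent vector being given by its
   components in [chart_at SM p].  Linear maps act on row vectors from the
   right: the derivative of f at p sends u to u *m tangent_map SM SN f p. *)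
Definition tangent_map (M N : topologicalType) (m n : nat)
    (SM : manifold R M m) (SN : manifold R N n) (f : M -> N) (p : M)
    : 'M[R]_(m, n) :=
  'J (chart_at SN (f p) \o f \o coord_inv (chart_at SM p)) (chart_at SM p p).

(* u *m coord_frame SM c x is the tangent vector at coord_inv c x whose
   components in the chart c are u. *)
Definition coord_frame (M : topologicalType) (m : nat) (SM : manifold R M m)
    (c : chart R M m) (x : 'rV[R]_m) : 'M[R]_m :=
  'J (chart_at SM (coord_inv c x) \o coord_inv c) x.

Definition smooth_tensor (M : topologicalType) (m k : nat)
    (SM : manifold R M m) (T : M -> ('I_k -> 'rV[R]_m) -> R) : Prop :=
  forall c, atlas SM c -> forall v : 'I_k -> 'rV[R]_m,
    smooth_on (target c)
      (fun x => T (coord_inv c x) (fun i => v i *m coord_frame SM c x)).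

(* Elements of the exterior algebra of the dual of 'rV_n, as families of
   k-linear alternating functions (k : nat). *)
Definition mform (n : nat) := forall k : nat, ('I_k -> 'rV[R]_n) -> R.

Definition is_mform (n : nat) (a : mform n) : Prop :=
  (forall k (v : 'I_k -> 'rV[R]_n) i (t : R) x y,
    a k (@dfwith 'I_k (fun=> 'rV[R]_n) v i (t *: x + y)) =
    t * a k (@dfwith 'I_k (fun=> 'rV[R]_n) v i x) + a k (@dfwith 'I_k (fun=> 'rV[R]_n) v i y)) /\
  (forall k (v : 'I_k -> 'rV[R]_n) i j, i != j -> v i = v j -> a k v = 0).

Definition mform1 (n : nat) : mform n := fun k _ => (k == 0)%:R.

Definition mform2 (n : nat) (b : 'rV[R]_n -> 'rV[R]_n -> R) : mform n :=
  fun k => match k return ('I_k -> 'rV[R]_n) -> R with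
           | 2 => fun v => b (v ord0) (v ord_max)
           | _ => fun _ => 0
           end.

Definition shuffle_inv (k : nat) (S : {set 'I_k}) : nat :=
  #|[set ij : 'I_k * 'I_k |
      [&& ij.1 \in S, ij.2 \notin S & (ij.2 < ij.1)%N]]|.

(* The sum over shuffles: a (resp. b) is evaluated on the arguments with index
   in S (resp. not in S), in increasing order. *)
Definition wedge (n : nat) (a b : mform n) : mform n := fun k v =>
  \sum_(S : {set 'I_k}) (-1) ^+ shuffle_inv S *
    a #|S| (fun i => v (enum_val i)) * b #|~: S| (fun i => v (enum_val i)).

(* Exponential in the exterior algebra of a form without component of
   degree 0; its j-th power then has no component of degree k < j. *)
Definition mexp (n : nat) (a : mform n) : mform n := fun k v =>
  \sum_(j < k.+1) j`!%:R^-1 * iter j (wedge a) (@mform1 n) k v.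

Definition pullback (m n : nat) (A : 'M[R]_(m, n)) (a : mform n) : mform m :=
  fun k v => a k (fun i => v i *m A).

Definition differential_form (M : topologicalType) (m : nat)
    (SM : manifold R M m) (a : M -> mform m) : Prop :=
  (forall p, is_mform (a p)) /\
  (forall k, smooth_tensor SM (fun p => a p k)).

Definition top_degree_volume_form (M : topologicalType) (m : nat)
    (a : M -> mform m) : Prop :=
  forall p, exists v : 'I_m -> 'rV[R]_m, a p m v != 0.

Definition is_path (T : topologicalType) (x y : T) (f : R -> T) : Prop :=
  [/\ {within `[0, 1], continuous f}, f 0 = x & f 1 = y].

Definition simply_connected (T : topologicalType) : Prop :=
  (forall x y : T, exists f, is_path x y f) /\
  (forall (x y : T) f g, is_path x y f -> is_path x y g ->
    exists H : R * R -> T,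
      [/\ {within `[0, 1]%classic `*` `[0, 1]%classic, continuous H},
          forall t : R, 0 <= t <= 1 -> H (0, t) = f t,
          forall t : R, 0 <= t <= 1 -> H (1, t) = g t
        & forall s : R, 0 <= s <= 1 -> H (s, 0) = x /\ H (s, 1) = y]).

End Manifolds.

#[short(type="topGroupType")]
HB.structure Definition TopGroup := {G of monoid.Group G & Topological G}.

(* Smoothness of the multiplication is smoothness on the product manifold,
   expressed in product charts. *)
Record lie_group (R : realType) (G : topGroupType) (n : nat) := LieGroup {
  lie_manifold :> manifold R G n;
  lie_mul_continuous : continuous (fun gh : G * G => (gh.1 * gh.2)%g);
  lie_mul_smooth : forall c1 c2 c3 : chart R G n,
    atlas lie_manifold c1 -> atlas lie_manifold c2 -> atlas lie_manifold c3 ->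
    smooth_on
      [set xy : 'rV[R]_n * 'rV[R]_n | [/\ target c1 xy.1, target c2 xy.2
        & source c3 (coord_inv c1 xy.1 * coord_inv c2 xy.2)%g]]
      (fun xy => c3 (coord_inv c1 xy.1 * coord_inv c2 xy.2)%g);
  lie_inv_smooth : smooth_map lie_manifold lie_manifold (fun g : G => g^-1%g)
}.

Section LieGroups.
Variables (R : realType) (G : topGroupType) (n : nat) (LG : lie_group R G n).

Definition conjugation (g h : G) : G := (g * h * g^-1)%g.

Definition left_translation_map (g h : G) : 'M[R]_n :=
  tangent_map LG LG (fun x : G => (g * x)%g) h.
Definition right_translation_map (g h : G) : 'M[R]_n :=
  tangent_map LG LG (fun x : G => (x * g)%g) h.
Definition conjugation_map (g h : G) : 'M[R]_n :=
  tangent_map LG LG (conjugation g) h.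

(* The Lie algebra is the tangent space at 1. *)
Definition Ad (g : G) : 'M[R]_n := conjugation_map g 1%g.

Definition left_field (xi : 'rV[R]_n) (g : G) : 'rV[R]_n :=
  xi *m left_translation_map g 1%g.
Definition right_field (xi : 'rV[R]_n) (g : G) : 'rV[R]_n :=
  xi *m right_translation_map g 1%g.
Definition generating_field (xi : 'rV[R]_n) (g : G) : 'rV[R]_n :=
  left_field xi g - right_field xi g.

Definition thetaL (g : G) (X : 'rV[R]_n) : 'rV[R]_n :=
  X *m left_translation_map g^-1%g g.

Definition Ad_invariant (B : {symmetric 'rV[R]_n}) : Prop :=
  forall g u v, B (u *m Ad g) (v *m Ad g) = B u v.

Definition bi_invariant_metric (mu : G -> {symmetric 'rV[R]_n}) : Prop :=
  [/\ forall g, nondegenerate (mu g),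
      smooth_tensor LG (fun g (v : 'I_2 -> 'rV[R]_n) =>
        mu g (v ord0) (v ord_max)),
      forall g h u v, mu (g * h)%g (u *m left_translation_map g h)
                                   (v *m left_translation_map g h) = mu h u v
    & forall g h u v, mu (h * g)%g (u *m right_translation_map g h)
                                   (v *m right_translation_map g h) = mu h u v].

Definition metric_of_form (mu : G -> {symmetric 'rV[R]_n})
    (B : {symmetric 'rV[R]_n}) : Prop :=
  forall g u v, mu g u v = B (thetaL g u) (thetaL g v).

(* B (D thetaL, thetaL) at g. *)
Definition thetaL_form (B : {symmetric 'rV[R]_n}) (D : 'M[R]_n) (g : G)
    (X Y : 'rV[R]_n) : R :=
  B (thetaL g X *m D) (thetaL g Y) - B (thetaL g Y *m D) (thetaL g X).

Definition cayley (A : 'M[R]_n) : 'M[R]_n := (1%:M - A) *m invmx (1%:M + A).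

(* The sign of the square root s is constrained only by smoothness and by the
   normalization at 1. *)
Definition is_psi (B : {symmetric 'rV[R]_n}) (psi : G -> mform R n) : Prop :=
  [/\ differential_form LG psi,
      forall g h k v,
        pullback (conjugation_map g h) (psi (conjugation g h)) v
        = psi h k v,
      forall k v, psi 1%g k v = mform1 v
    & forall g, Ad g + 1%:M \in unitmx ->
        exists s : R, s ^+ 2 = \det (2^-1 *: (Ad g + 1%:M)) /\
          forall k v, psi g k v =
            s * mexp (mform2 (fun X Y =>
                  4^-1 * thetaL_form B (cayley (Ad g)) g X Y)) v].

Section ConjugacyClass.
Variables (C : topologicalType) (d : nat) (SC : manifold R C d) (iota : C -> G).

(* iota exhibits C, with the manifold structure SC of the homogeneous space
   G / Z(a), as the conjugacy class of a. *)
Definition is_conjugacy_class (a : G) : Prop :=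
  [/\ injective iota,
      range iota = [set conjugation g a | g in [set: G]],
      smooth_map SC LG iota /\ (forall c, row_free (tangent_map SC LG iota c))
    & exists orb : G -> C,
        [/\ forall g, iota (orb g) = conjugation g a,
            smooth_map LG SC orb
          & forall g, row_full (tangent_map LG SC orb g)]].

Definition is_GHJW_form (B : {symmetric 'rV[R]_n})
    (omega : C -> 'rV[R]_d -> 'rV[R]_d -> R) : Prop :=
  [/\ differential_form SC (fun c => mform2 (omega c)),
      forall g c c' u1 u2 u1' u2', iota c' = conjugation g (iota c) ->
        u1' *m tangent_map SC LG iota c' =
          u1 *m tangent_map SC LG iota c *m conjugation_map g (iota c) ->
        u2' *m tangent_map SC LG iota c' =
          u2 *m tangent_map SC LG iota c *m conjugation_map g (iota c) ->
        omega c' u1' u2' = omega c u1 u2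
    & forall c u1 u2 xi1 xi2,
        u1 *m tangent_map SC LG iota c = generating_field xi1 (iota c) ->
        u2 *m tangent_map SC LG iota c = generating_field xi2 (iota c) ->
        omega c u1 u2 =
          - B (xi1 *m (2^-1 *: (Ad (iota c) - Ad (iota c)^-1%g))) xi2].

End ConjugacyClass.
End LieGroups.

(* Main.v *)
(** Let [g = iota c], [A = Ad_g], let [V] be the matrix of the left-trivialized
    tangent space of the conjugacy class at [g] and [Omega] that of [omega].
    If [A + 1] is invertible, [e^omega iota^*psi] is [s] times the exponential
    of a 2-form on the tangent space, so by [Pf^2 = det] the square of its top
    coefficient is [s^2] times a determinant.  A Schur complement turns this
    into [2^-n] times the determinant of
      [[A + 1, - B V^T / 2], [V (1 - A), Omega]],
    which no longer involves [(A + 1)^-1] and is continuous in [g].  As the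
    points with [A + 1] invertible are dense, the identity holds everywhere.
    The block matrix is always invertible: if [(w, u)] is in its kernel and
    [x = u V = xi (1 - A^-1)], then [w = - x], whence [x A = 0].

    Density does not need analyticity of [G]: [det (A + 1)] is a coefficient of
    a finite-dimensional representation of [G] (a tensor power of the sum of
    the trivial representation and [Ad]), and such a coefficient vanishes
    identically on the connected group [G] as soon as it vanishes near a point. *)
Require Import Defs.
From mathcomp Require Import all_boot all_order all_algebra all_fingroup.
From mathcomp Require Import all_classical all_reals all_analysis.
From mathcomp Require Import ring lra.

Set Implicit Arguments.
Unset Strict Implicit.
Unset Printing Implicit Defensive.

Import Order.TTheory GRing.Theory Num.Theory.
Import numFieldNormedType.Exports.

Local Open Scope ring_scope.

(** * The exterior algebra as a shuffle algebra *)

(* An element of the exterior algebra is given by its values on all lists of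
   vectors.  The product is determined by its degree 0 part and by the fact
   that contraction with the first vector is an antiderivation; its algebraic
   laws need neither multilinearity nor alternation. *)
Section ShuffleAlgebra.
Variables (R : numFieldType) (T : Type).
Implicit Types (a b c : seq T -> R) (x y : T) (s t : seq T).

Definition contract x a : seq T -> R := fun s => a (x :: s).
(** The grading automorphism, which carries the sign picked up by a contraction that passes a
    factor. *)
Definition bar a : seq T -> R := fun s => (-1) ^+ size s * a s.
Definition one_form : seq T -> R := fun s => (nilp s)%:R.
Definition zero_form : seq T -> R := fun=> 0.
Definition form1 (f : T -> R) : seq T -> R :=
  fun s => if s is [:: x] then f x else 0.
Definition form2 (f : T -> T -> R) : seq T -> R :=
  fun s => if s is [:: x; y] then f x y else 0.

(** The antiderivation rule is built into the recursion, so that [contract_shuffle] holds by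
    computation. *)
Fixpoint shuffle_rec s a b : R :=
  if s is x :: s' then
    shuffle_rec s' (contract x a) b + shuffle_rec s' (bar a) (contract x b)
  else a [::] * b [::].
Definition shuffle a b : seq T -> R := fun s => shuffle_rec s a b.
Local Notation "a ** b" := (shuffle a b) (at level 40, left associativity).

Lemma contract_shuffle x a b :
  contract x (a ** b) = contract x a ** b \+ bar a ** contract x b.
Proof. by []. Qed.

Lemma contract_bar x a : contract x (bar a) = -1 \*o bar (contract x a).
Proof. by apply/funext => s; rewrite /contract /bar /= exprS !mulrA. Qed.

Lemma barK a : bar (bar a) = a.
Proof. by apply/funext => s; rewrite /bar mulrA -expr2 sqrr_sign mul1r. Qed.

Lemma barD a b : bar (a \+ b) = bar a \+ bar b.
Proof. by apply/funext => s; rewrite /bar /= mulrDr. Qed.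

Lemma barZ k a : bar (k \*o a) = k \*o bar a.
Proof. by apply/funext => s; rewrite /bar /= mulrCA. Qed.

Lemma shuffleDl a b c : (a \+ b) ** c = a ** c \+ b ** c.
Proof.
apply/funext => s; rewrite /shuffle /=.
elim: s a b c => [|x s IH] a b c /=; first by rewrite mulrDl.
by rewrite -[contract x _]/(contract x a \+ contract x b) barD !IH addrACA.
Qed.

Lemma shuffleDr a b c : a ** (b \+ c) = a ** b \+ a ** c.
Proof.
apply/funext => s; rewrite /shuffle /=.
elim: s a b c => [|x s IH] a b c /=; first by rewrite mulrDr.
by rewrite -[contract x (b \+ c)]/(contract x b \+ contract x c) !IH addrACA.
Qed.

Lemma shuffleZl k a b : (k \*o a) ** b = k \*o (a ** b).
Proof.
apply/funext => s; rewrite /shuffle /=.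
elim: s a b => [|x s IH] a b /=; first by rewrite mulrA.
by rewrite -[contract x _]/(k \*o contract x a) barZ !IH mulrDr.
Qed.

Lemma shuffleZr k a b : a ** (k \*o b) = k \*o (a ** b).
Proof.
apply/funext => s; rewrite /shuffle /=.
elim: s a b => [|x s IH] a b /=; first by rewrite mulrCA.
by rewrite -[contract x (k \*o b)]/(k \*o contract x b) !IH mulrDr.
Qed.

Lemma bar_shuffle a b : bar (a ** b) = bar a ** bar b.
Proof.
apply/funext => s; rewrite {1}/bar /shuffle.
elim: s a b => [|x s IH] a b /=; first by rewrite /bar /= !mul1r.
rewrite !contract_bar -!/(shuffle _ _ _) shuffleZl shuffleZr /= /shuffle -!IH exprS.
by rewrite -mulrDr -mulrA; congr (_ * _); rewrite -mulrDr.
Qed.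

Lemma shuffle0l a : zero_form ** a = zero_form.
Proof.
have -> : zero_form = 0 \*o one_form.
  by apply/funext => s; rewrite /= mul0r.
by rewrite shuffleZl; apply/funext => s; rewrite /= !mul0r.
Qed.

Lemma shuffle0r a : a ** zero_form = zero_form.
Proof.
have -> : zero_form = 0 \*o one_form.
  by apply/funext => s; rewrite /= mul0r.
by rewrite shuffleZr; apply/funext => s; rewrite /= !mul0r.
Qed.

Lemma contract_one_form x : contract x one_form = zero_form.
Proof. by []. Qed.

Lemma bar_one_form : bar one_form = one_form.
Proof. by apply/funext => -[|x s]; rewrite /bar /one_form ?mulr1 // mulr0. Qed.

Lemma shuffle1l a : one_form ** a = a.
Proof.
apply/funext => s; rewrite /shuffle.
elim: s a => [|x s IH] a /=; first by rewrite mul1r.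
by rewrite bar_one_form IH contract_one_form -/(shuffle _ _ _) shuffle0l add0r.
Qed.

Lemma shuffle1r a : a ** one_form = a.
Proof.
apply/funext => s; rewrite /shuffle.
elim: s a => [|x s IH] a /=; first by rewrite mulr1.
by rewrite IH contract_one_form -/(shuffle _ _ _) shuffle0r addr0.
Qed.

Lemma shuffleA a b c : a ** (b ** c) = a ** b ** c.
Proof.
apply/funext => s.
elim: s a b c => [|x s IH] a b c; first by rewrite /shuffle /= mulrA.
rewrite -/(contract x (a ** (b ** c)) s) -/(contract x (a ** b ** c) s).
rewrite !contract_shuffle shuffleDl shuffleDr bar_shuffle /=.
by rewrite !IH addrA.
Qed.

Definition even_form a := bar a = a.
Definition odd_form a := bar a = -1 \*o a.

Lemma even_contract x a : even_form a -> odd_form (contract x a).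
Proof.
move=> ea; rewrite /odd_form -[in RHS]ea contract_bar.
by apply/funext => s; rewrite /= mulrA mulrNN !mul1r.
Qed.

Lemma odd_contract x a : odd_form a -> even_form (contract x a).
Proof.
move=> oa; have := contract_bar x a; rewrite oa => h.
apply/funext => s; have /(congr1 (@^~ s)) := h.
by rewrite /contract /= !mulN1r => /oppr_inj <-.
Qed.

(** The even and odd cases need a joint induction, since contraction exchanges the parities. *)
Lemma shuffle_gradedC a b :
  (even_form a -> a ** b = b ** a) /\ (odd_form a -> a ** b = bar b ** a).
Proof.
suff H s : (even_form a -> (a ** b) s = (b ** a) s) /\
           (odd_form a -> (a ** b) s = (bar b ** a) s).
  by split=> h; apply/funext => s; have [h1 h2] := H s; auto.
elim: s a b => [|x s IH] a b.
  by split=> _; rewrite /shuffle /= mulrC // /bar mul1r.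
have ctrE a' b' : (a' ** b') (x :: s) = contract x (a' ** b') s by [].
split=> ha; rewrite !ctrE !contract_shuffle /=.
  rewrite ha [in RHS]addrC.
  congr (_ + _); first by apply: (IH _ _).2; apply: even_contract.
  exact: (IH _ _).1.
rewrite barK contract_bar shuffleZl ha shuffleZl /= addrC.
congr (_ * _ + _); first exact: (IH _ _).2.
by apply: (IH _ _).1; apply: odd_contract.
Qed.

Lemma even_shuffleC a b : even_form a -> a ** b = b ** a.
Proof. exact: (shuffle_gradedC a b).1. Qed.

Lemma odd_shuffleC a b : odd_form a -> a ** b = bar b ** a.
Proof. exact: (shuffle_gradedC a b).2. Qed.

Lemma even_one_form : even_form one_form. Proof. exact: bar_one_form. Qed.

Lemma even_shuffle a b : even_form a -> even_form b -> even_form (a ** b).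
Proof. by move=> ea eb; rewrite /even_form bar_shuffle ea eb. Qed.

Lemma odd_form1 f : odd_form (form1 f).
Proof.
by apply/funext => -[|x [|y s]]; rewrite /bar /= ?mulr0.
Qed.

Lemma even_form2 f : even_form (form2 f).
Proof.
apply/funext => -[|x [|y [|z s]]]; rewrite /bar /= ?mulr0 //.
by rewrite sqrrN expr1n mul1r.
Qed.

Lemma contract_form2 f x : contract x (form2 f) = form1 (f x).
Proof. by apply/funext => -[|y [|z s]]. Qed.

Lemma contract_form1 f x : contract x (form1 f) = f x \*o one_form.
Proof. by apply/funext => -[|y s]; rewrite /= ?mulr1 ?mulr0. Qed.

Lemma form1_sq f : form1 f ** form1 f = zero_form.
Proof.
have := odd_shuffleC (form1 f) (odd_form1 f).
rewrite odd_form1 shuffleZl => h; apply/funext => s.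
have /(congr1 (@^~ s)) /= /esym/eqP := h.
by rewrite mulN1r eqNr => /eqP.
Qed.

Lemma form1_shuffle f g : form1 f ** form1 g =
  form2 (fun u w => f u * g w - f w * g u).
Proof.
apply/funext => -[|u s]; first by rewrite /shuffle /= mul0r.
rewrite -/(contract u (_ ** _) s) -/(contract u (form2 _) s).
rewrite contract_shuffle contract_form2 !contract_form1 odd_form1.
rewrite shuffleZr !shuffleZl shuffle1l shuffle1r /=.
by case: s => [|w [|z s]] /=; ring.
Qed.

Lemma eq_shuffle_le a b b' s :
  (forall t, (size t <= size s)%N -> b t = b' t) -> (a ** b) s = (a ** b') s.
Proof.
elim: s a b b' => [|x s IH] a b b' h; first by rewrite /shuffle /= h.
rewrite -!/(contract x (_ ** _) s) !contract_shuffle /=; congr (_ + _).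
  by apply: IH => t ht; apply: h; apply: leq_trans ht _.
by apply: IH => t ht; apply: h.
Qed.

(** Every nonzero term spends at least one argument on [a], so [b] only sees shorter lists; this
    allows recursion on length. *)
Lemma eq_shuffle_lt a b b' s : a [::] = 0 ->
  (forall t, (size t < size s)%N -> b t = b' t) -> (a ** b) s = (a ** b') s.
Proof.
elim: s a b b' => [|x s IH] a b b' a0 h; first by rewrite /shuffle /= a0 !mul0r.
rewrite -!/(contract x (_ ** _) s) !contract_shuffle /=; congr (_ + _).
  exact: eq_shuffle_le.
by apply: IH => [|t ht]; [rewrite /bar a0 mulr0|exact: h].
Qed.

Definition shuffle_pow (j : nat) a : seq T -> R := iter j (shuffle a) one_form.

Lemma shuffle_pow_small j a s : a [::] = 0 -> (size s < j)%N -> shuffle_pow j a s = 0.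
Proof.
move=> a0; elim: j s => // j IH s hs.
rewrite /shuffle_pow /= -/(shuffle_pow j a) (@eq_shuffle_lt _ _ zero_form) ?shuffle0r // => t ht.
by apply: IH; apply: leq_trans ht _.
Qed.

Lemma even_shuffle_pow j a : even_form a -> even_form (shuffle_pow j a).
Proof. by move=> ea; elim: j => [|j]; [exact: even_one_form|exact: even_shuffle]. Qed.

(** An even element commutes with everything, so contraction differentiates its powers by the usual
    power rule. *)
Lemma contract_shuffle_pow x j a : even_form a ->
  contract x (shuffle_pow j.+1 a) = j.+1%:R \*o (contract x a ** shuffle_pow j a).
Proof.
move=> ea; elim: j => [|j IH]; apply/funext => s.
  by rewrite /shuffle_pow /= shuffle1r shuffle1r mul1r.
rewrite -[shuffle_pow j.+2 a]/(a ** shuffle_pow j.+1 a) contract_shuffle ea IH.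
rewrite shuffleZr shuffleA (even_shuffleC (contract x a)) // -shuffleA /=.
by rewrite -[j.+2]addn1 natrD addrC mulrDl mul1r.
Qed.

(** The truncated sum is the whole exponential series when [a] has no degree 0 part, by
    [shuffle_pow_small]. *)
Definition shuffle_exp a : seq T -> R :=
  fun s => \sum_(j < (size s).+1) j`!%:R^-1 * shuffle_pow j a s.

Lemma shuffle_exp_widen a s N : a [::] = 0 -> (size s < N)%N ->
  shuffle_exp a s = \sum_(j < N) j`!%:R^-1 * shuffle_pow j a s.
Proof.
move=> a0 hN; rewrite /shuffle_exp.
rewrite (big_ord_widen N (fun j => j`!%:R^-1 * shuffle_pow j a s)) // big_mkcond /=.
apply: eq_bigr => j _; case: ifPn => //; rewrite -leqNgt => hj.
by rewrite shuffle_pow_small ?mulr0.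
Qed.

Lemma shuffle_sumr (I : finType) a (F : I -> seq T -> R) s :
  (a ** (fun t => \sum_i F i t)) s = \sum_i (a ** F i) s.
Proof.
elim: (index_enum I) => [|i r IH].
  rewrite big_nil -[RHS](congr1 (@^~ s) (shuffle0r a)).
  by congr (shuffle _ _ s); apply/funext => t; rewrite big_nil.
rewrite big_cons -IH.
transitivity ((a ** (F i \+ fun t => \sum_(i <- r) F i t)) s).
  by congr (shuffle _ _ s); apply/funext => t /=; rewrite big_cons.
by rewrite shuffleDr.
Qed.

Lemma shuffle_exp0 a : shuffle_exp a [::] = 1.
Proof. by rewrite /shuffle_exp big_ord1 /shuffle_pow /= invr1 mul1r. Qed.

Lemma contract_shuffle_exp x a : even_form a -> a [::] = 0 ->
  contract x (shuffle_exp a) = contract x a ** shuffle_exp a.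
Proof.
move=> ea a0; apply/funext => s; rewrite {1}/contract /shuffle_exp big_ord_recl /=.
rewrite mulr0 add0r.
rewrite (@eq_shuffle_le _ _ (fun t => \sum_(j < (size s).+1)
  (j`!%:R^-1 \*o shuffle_pow j a) t)); last by move=> t ht; apply: shuffle_exp_widen.
rewrite shuffle_sumr; apply: eq_bigr => j _.
rewrite /bump /= add1n [X in _ * X](congr1 (@^~ s) (contract_shuffle_pow x j ea)).
rewrite shuffleZr /= mulrA; congr (_ * _).
by rewrite factS natrM invfM mulrAC mulVf ?mul1r // pnatr_eq0.
Qed.

(** The exponential solves a linear first-order equation. Contraction lowers the length, so the
    value on the empty list determines the solution. *)
Lemma shuffle_exp_unique a b : a [::] = 0 -> even_form a -> b [::] = 1 ->
  (forall x, contract x a [::] = 0) ->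
  (forall x, contract x b = contract x a ** b) -> b = shuffle_exp a.
Proof.
move=> a0 ea b1 ca cb; apply/funext => s.
have [m] := ubnP (size s); elim: m s => // m IH [|x s] hs.
  by rewrite b1 shuffle_exp0.
rewrite -/(contract x b s) -/(contract x (shuffle_exp a) s) cb contract_shuffle_exp //.
by apply: eq_shuffle_lt => // t ht; apply: IH; apply: leq_trans ht (ltnW hs).
Qed.

Lemma even_shuffle_exp a : even_form a -> even_form (shuffle_exp a).
Proof.
move=> ea; apply/funext => s; rewrite /bar /shuffle_exp mulr_sumr.
apply: eq_bigr => j _; rewrite mulrCA; congr (_ * _).
by rewrite -[RHS](congr1 (@^~ s) (even_shuffle_pow j ea)).
Qed.

(** The product solves the equation of [shuffle_exp_unique] for the sum, because the even element
    [shuffle_exp (form2 f)] commutes with contractions of [form2 g]. *)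
Lemma shuffle_exp_form2D f g : shuffle_exp (form2 f) ** shuffle_exp (form2 g) =
  shuffle_exp (form2 (fun x y => f x y + g x y)).
Proof.
apply: shuffle_exp_unique => [//|||//|x]; first exact: even_form2.
  by rewrite /shuffle /= !shuffle_exp0 mulr1.
have -> : contract x (form2 (fun x y => f x y + g x y)) =
  contract x (form2 f) \+ contract x (form2 g).
  rewrite !contract_form2.
  by apply/funext => -[|y [|z s]] //=; rewrite addr0.
rewrite contract_shuffle !contract_shuffle_exp //; try exact: even_form2.
rewrite (even_shuffle_exp (even_form2 f)) shuffleDl !shuffleA.
rewrite (even_shuffleC (contract x (form2 g)) (even_shuffle_exp (even_form2 f))).
by [].
Qed.

Definition anti a := forall l x y r, a (l ++ x :: y :: r) = - a (l ++ y :: x :: r).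

Lemma anti_contract x a : anti a -> anti (contract x a).
Proof. by move=> h l; exact: (h (x :: l)). Qed.

Lemma anti_bar a : anti a -> anti (bar a).
Proof. by move=> h l x y r; rewrite /bar h !size_cat /= mulrN. Qed.

Lemma anti_shuffle a b : anti a -> anti b -> anti (a ** b).
Proof.
move=> ha hb l; elim: l a b ha hb => [|z l IH] a b ha hb x y r; last first.
  rewrite !cat_cons -!/(contract z (a ** b) _) !contract_shuffle /= opprD.
  by congr (_ + _); apply: IH => //; do ?[exact: anti_contract|exact: anti_bar].
have E x' y' : (a ** b) (x' :: y' :: r) =
   contract y' (contract x' (a ** b)) r by [].
have D c d x' : contract x' (c \+ d) = contract x' c \+ contract x' d by [].
have Z k c x' : contract x' (k \*o c) = k \*o contract x' c by [].
have A c x' y' : anti c -> contract x' (contract y' c) =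
    -1 \*o contract y' (contract x' c).
  by move=> hc; apply/funext => s; rewrite /= mulN1r; exact: (hc [::]).
(* Two contractions expand the product into four terms: on a single factor contractions anticommute,
   and the two mixed terms trade places with opposite signs. *)
rewrite !cat0s !E !contract_shuffle !D !contract_shuffle !contract_bar !barK.
rewrite (A a y x) // (A b y x) // !(shuffleZl, shuffleZr) /=.
by ring.
Qed.

Lemma anti_one_form : anti one_form.
Proof. by move=> l x y r; rewrite /one_form /nilp !size_cat /= !addnS oppr0. Qed.

Lemma anti_form2 f : (forall x y, f x y = - f y x) -> anti (form2 f).
Proof.
move=> hf [|z [|w [|? l]]] x y r /=; rewrite ?oppr0 //.
by case: r => [|? ?]; rewrite ?oppr0.
Qed.

Lemma anti_shuffle_exp a : anti a -> anti (shuffle_exp a).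
Proof.
move=> h l x y r; rewrite /shuffle_exp !size_cat /= -sumrN.
apply: eq_bigr => j _; rewrite -mulrN; congr (_ * _).
move: (nat_of_ord j) => m {j}; elim: m l x y r => [|m IH]; first exact: anti_one_form.
by apply: anti_shuffle.
Qed.

Lemma anti_sqr_move a : anti a -> forall p l y r,
  a (p ++ l ++ y :: r) ^+ 2 = a (p ++ y :: l ++ r) ^+ 2.
Proof.
move=> h p l; elim/last_ind: l p => [|l z IH] p y r //.
rewrite cat_rcons catA h sqrrN -catA IH cat_rcons.
by [].
Qed.

End ShuffleAlgebra.
Arguments one_form {R T} s.
Arguments zero_form {R T} s.

Local Notation "a ** b" := (shuffle a b) (at level 40, left associativity).

(** * Pfaffians and determinants *)

Lemma det_block_schur (R : comUnitRingType) m n (A W : 'M[R]_m) (B : 'M[R]_(m, n))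
    (C : 'M[R]_(n, m)) (D : 'M[R]_n) :
  A *m W = 1%:M ->
  \det (block_mx A B C D) = \det A * \det (D - C *m W *m B).
Proof.
move=> AW; have WA := mulmx1C AW.
rewrite -(det_ublock A B) -[RHS]mul1r.
have <- : \det (block_mx 1%:M 0 (C *m W) 1%:M) = 1 :> R.
  by rewrite det_lblock !det1 mulr1.
rewrite -det_mulmx mulmx_block !mul1mx !mul0mx !addr0.
by rewrite -!mulmxA WA mulmx1 addrC subrK.
Qed.

Section Pfaffian.
Variables (R : numFieldType) (T : eqType) (x0 : T).
Implicit Types (f : T -> T -> R) (x y : T) (s : seq T).

Definition gram_det f s : R :=
  \det (\matrix_(i < size s, j < size s) f (nth x0 s i) (nth x0 s j)).

(** Rows and columns are permuted simultaneously, so the sign of the permutation occurs twice. *)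
Lemma gram_det_perm f s t : perm_eq s t -> gram_det f s = gram_det f t.
Proof.
move=> st; have /tuple_permP [p sE] : perm_eq s (in_tuple t) by [].
have szE := perm_size st.
rewrite /gram_det szE.
set G := (X in _ = \det X).
have -> : (\matrix_(i, j) f (nth x0 s i) (nth x0 s j)) = row_perm p (col_perm p G).
  apply/matrixP => i j; rewrite !mxE sE -!tnth_nth !tnth_mktuple.
  by rewrite !(tnth_nth x0).
rewrite row_permE col_permE !det_mulmx !det_perm mulrCA.
by rewrite odd_permV -signr_addb addbb mulr1.
Qed.

(** For an alternating bilinear [f] with [f x y] nonzero, this is [f] on the components of [u] and
    [w] orthogonal to [x] and [y]. *)
Definition schur_form x y f : T -> T -> R := fun u w =>
  f u w - (f x y)^-1 * (f x u * f y w - f x w * f y u).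

Lemma gram_det_schur f x y s : (forall u w, f u w = - f w u) ->
  f x y != 0 ->
  gram_det f (x :: y :: s) = f x y ^+ 2 * gram_det (schur_form x y f) s.
Proof.
move=> fN pN0.
have f0 u : f u u = 0 by apply/eqP; rewrite -eqNr -fN.
rewrite /gram_det.
pose G : 'M[R]_(2 + size s) := \matrix_(i, j)
  f (nth x0 (x :: y :: s) i) (nth x0 (x :: y :: s) j).
rewrite -[X in \det X = _]/G -(submxK G).
(* The inverse of the upper left block [[0, p], [-p, 0]], where [p = f x y]. *)
pose W : 'M[R]_2 := \matrix_(i, j)
  if (i < j)%N then - (f x y)^-1 else if (j < i)%N then (f x y)^-1 else 0.
have GW : ulsubmx G *m W = 1%:M.
  apply/matrixP => i j; rewrite !mxE !big_ord_recl big_ord0 !mxE /=.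
  case: i => [[|[|//]] ?]; case: j => [[|[|//]] ?] /=;
    rewrite ?f0 ?(fN y x) ?mulr0 ?mul0r ?addr0 ?add0r ?mulrNN ?mulfV //.
rewrite (det_block_schur _ _ _ GW); congr (_ * _).
  rewrite (expand_det_row _ ord0) !big_ord_recl big_ord0 /cofactor !det_mx11.
  by rewrite !mxE /= !f0 (fN y x) /bump /=; ring.
congr (\det _); apply/matrixP => i j.
rewrite !mxE !big_ord_recl big_ord0 !mxE !big_ord_recl !big_ord0 !mxE /=.
rewrite /schur_form (fN _ x) (fN _ y).
by ring.
Qed.

(** The induction splits off two vectors [x], [y] with [f x y] nonzero; both sides then acquire the
    factor [f x y ^+ 2]. *)
Lemma sqr_shuffle_exp_form2 f s : (forall u w, f u w = - f w u) ->
  shuffle_exp (form2 f) s ^+ 2 = gram_det f s.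
Proof.
have [m] := ubnP (size s); elim: m s f => // m IH [|x s] f hs fN.
  by rewrite shuffle_exp0 expr1n /gram_det det_mx00.
have f0 u : f u u = 0 by apply/eqP; rewrite -eqNr -fN.
(* If [x] pairs to zero with every entry, both sides vanish: the Gram matrix has a zero row, and
   contraction with [x] leaves nothing on [s]. *)
have [/hasP[y ys pN0]|/hasPn f_0] := boolP (has (fun y => f x y != 0) s); last first.
  have -> : shuffle_exp (form2 f) (x :: s) = 0.
    rewrite -/(contract x _ s) contract_shuffle_exp ?contract_form2 //; last first.
      exact: even_form2.
    elim: s f_0 (shuffle_exp _) {hs} => [|z s IHs] f_0 b; first by rewrite /shuffle /= mul0r.
    have fz : f x z = 0 by apply/eqP; have := f_0 z (mem_head _ _); rewrite negbK.
    rewrite -/(contract z (_ ** _) s) contract_shuffle contract_form1 fz /=.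
    rewrite odd_form1 !shuffleZl /= mul0r add0r IHs ?mulr0 // => t ts.
    by apply: f_0; rewrite inE ts orbT.
  rewrite expr0n /=; apply/esym.
  rewrite /gram_det (expand_det_row _ ord0) big1 // => j _.
  rewrite mxE /=; case: j => [[|j] hj] /=; rewrite ?f0 ?mul0r //.
  have : nth x0 s j \in s by apply: mem_nth.
  by move=> /f_0; rewrite negbK => /eqP ->; rewrite mul0r.
(* Squaring removes the sign of moving the partner [y] next to [x]. *)
case/splitPr: ys hs => l r hs.
rewrite (@anti_sqr_move _ _ _ _ [:: x] l y r) /=; last first.
  exact/anti_shuffle_exp/anti_form2.
have pm : perm_eq (x :: l ++ y :: r) (x :: y :: l ++ r).
  by rewrite perm_cons -cat1s perm_catCA.
(* It remains to see that contracting e^f with x and y gives f(x,y) e^f' where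
   f' is the Schur complement of f with respect to x and y. *)
rewrite (gram_det_perm _ pm) gram_det_schur //.
rewrite -IH; last first.
- by move=> u w; rewrite /schur_form (fN u w); ring.
- by move: hs; rewrite /= !size_cat /= addnS => /ltnW.
rewrite -exprMn; congr (_ ^+ 2).
set t := l ++ r; set E := shuffle_exp (form2 f).
have cE z : contract z E = form1 (f z) ** E.
  by rewrite contract_shuffle_exp ?contract_form2 //; exact: even_form2.
rewrite -[LHS]/(contract y (contract x E) t) cE contract_shuffle contract_form1.
rewrite odd_form1 cE !shuffleZl shuffle1l.
(* The Schur complement is [f] plus the decomposable 2-form [c], whose square is zero; so its
   exponential is [one_form \+ c]. *)
pose c := form2 (fun u w => - (f x y)^-1 * (f x u * f y w - f x w * f y u)).
have cP : c = - (f x y)^-1 \*o (form1 (f x) ** form1 (f y)).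
  by rewrite form1_shuffle; apply/funext => -[|u [|w [|? ?]]] /=; rewrite ?mulr0.
have ExpS : shuffle_exp (form2 (schur_form x y f)) = shuffle_exp c ** E.
  rewrite shuffle_exp_form2D; congr (shuffle_exp (form2 _)); apply/funext => u; apply/funext => w.
  by rewrite /schur_form addrC mulNr.
have Expc : shuffle_exp c = one_form \+ c.
  apply/esym/shuffle_exp_unique => [//|||z|z]; first exact: even_form2.
  - by rewrite /= addr0.
  - by rewrite /c contract_form2.
  rewrite shuffleDr shuffle1r.
  have -> : contract z (one_form \+ c) = contract z c.
    by apply/funext => u; rewrite /contract /= add0r.
  suff -> : contract z c ** c = zero_form.
    by apply/funext => u; rewrite /= addr0.
  have cz : contract z c = (- (f x y)^-1 * f x z) \*o form1 (f y) \+
     ((f x y)^-1 * f y z) \*o form1 (f x).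
    rewrite /c contract_form2; apply/funext => -[|u [|? ?]] /=; ring.
  rewrite cz cP shuffleDl !(shuffleZl, shuffleZr).
  rewrite [in X in _ \+ X]shuffleA form1_sq shuffle0l.
  rewrite (odd_shuffleC (form1 (f y)) (@odd_form1 _ _ (f x))) odd_form1.
  rewrite shuffleZl shuffleZr shuffleA form1_sq shuffle0l.
  by apply/funext => u; rewrite /= /zero_form; ring.
rewrite ExpS Expc shuffleDl shuffle1l cP shuffleZl -shuffleA /=.
by rewrite mulrDr mulrA mulrN mulfV.
Qed.

End Pfaffian.

(** * Comparison of the wedge product with the shuffle product *)

Section Shuffles.
Variables (R : realType).

(* Subsets of 'I_k.+1 as pairs: whether 0 is a member, and the rest shifted. *)
Definition lift_set k (p : bool * {set 'I_k}) : {set 'I_k.+1} :=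
  let A := [set lift ord0 i | i in p.2] in if p.1 then ord0 |: A else A.

Definition unlift_set k (S : {set 'I_k.+1}) : bool * {set 'I_k} :=
  (ord0 \in S, [set i | lift ord0 i \in S]).

Lemma ord0_lift_set k p : (ord0 \in @lift_set k p) = p.1.
Proof.
have h : (ord0 \in [set lift ord0 i | i in p.2]) = false.
  by apply/imsetP => -[i _ /eqP]; rewrite (negPf (neq_lift _ _)).
by case: p h => -[] A h; rewrite /lift_set /= ?in_setU1 ?eqxx ?h.
Qed.

Lemma lift_lift_set k p i : (lift ord0 i \in @lift_set k p) = (i \in p.2).
Proof.
case: p => -[] A; rewrite /lift_set /= ?in_setU1 ?(mem_imset _ _ lift_inj) //.
Qed.

Lemma lift_setK k : cancel (@lift_set k) (@unlift_set k).
Proof.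
move=> p; rewrite /unlift_set ord0_lift_set.
rewrite (_ : [set i | _] = p.2) -?surjective_pairing //.
by apply/setP => i; rewrite inE lift_lift_set.
Qed.

Lemma unlift_setK k : cancel (@unlift_set k) (@lift_set k).
Proof.
move=> S; apply/setP => i; case: (unliftP ord0 i) => [j|] ->.
  by rewrite lift_lift_set /= inE.
by rewrite ord0_lift_set.
Qed.

Lemma enum_lift_set k p : enum (@lift_set k p) =
  nseq p.1 ord0 ++ [seq lift ord0 i | i <- enum p.2].
Proof.
rewrite {1}/enum_mem -enumT enum_ordSl /= ord0_lift_set filter_map.
rewrite (eq_filter (a2 := mem p.2)); last by move=> i; rewrite /= lift_lift_set.
rewrite [enum p.2]/enum_mem -enumT; by case: p.1.
Qed.

Lemma setC_lift_set k (p : bool * {set 'I_k}) :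
  ~: lift_set p = lift_set (~~ p.1, ~: p.2).
Proof.
apply/setP => i; rewrite inE; case: (unliftP ord0 i) => [j|] ->.
  by rewrite !lift_lift_set inE.
by rewrite !ord0_lift_set.
Qed.

Lemma shuffle_inv_sum k (S : {set 'I_k}) : shuffle_inv S =
  (\sum_(i < k) \sum_(j < k) [&& i \in S, j \notin S & (j < i)])%N.
Proof.
rewrite /shuffle_inv -sum1_card big_mkcond /= pair_big /=.
apply: eq_bigr => -[i j] _ /=.
by rewrite [_ \in _](asboolb [&& i \in S, j \notin S & (j < i)%N]); case: ifP.
Qed.

(** When 0 lies outside the set, it forms an inversion with each member; this count becomes the sign
    in [bar]. *)
Lemma shuffle_inv_lift_set k (p : bool * {set 'I_k}) :
  shuffle_inv (lift_set p) = (shuffle_inv p.2 + ~~ p.1 * #|p.2|)%N.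
Proof.
rewrite !shuffle_inv_sum big_ord_recl big1 ?add0n; last first.
  by move=> j _; rewrite ltn0 !andbF.
under eq_bigr => i _.
  rewrite big_ord_recl ord0_lift_set lift_lift_set /= andbT.
  under eq_bigr => j _ do rewrite !lift_lift_set /bump /= !add1n ltnS.
  over.
rewrite big_split /= addnC; congr (_ + _)%N.
rewrite -sum1_card big_distrr /= [RHS]big_mkcond /=.
by apply: eq_bigr => i _; case: (i \in p.2); case: p.1.
Qed.

(** Sorting subsets by whether they contain 0 gives the two terms of the recursion: the first vector
    goes to [a] or to [b]. *)
Lemma shuffle_sumE (T : Type) (a b : seq T -> R) k (v : 'I_k -> T) :
  \sum_(S : {set 'I_k}) (-1) ^+ shuffle_inv S *
    a [seq v i | i <- enum S] * b [seq v i | i <- enum (~: S)] =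
  (a ** b) [seq v i | i <- enum 'I_k].
Proof.
elim: k a b v => [|k IH] a b v.
  rewrite enum_ord0 /shuffle /= (big_pred1 finset.set0) => [|S]; last first.
    by rewrite /=; apply/esym/eqP/setP => -[].
  rewrite shuffle_inv_sum big_ord0 mul1r.
  have e0 (S : {set 'I_0}) : enum S = [::] by case: (enum _) => // -[].
  by rewrite !e0.
rewrite enum_ordSl /= -map_comp.
rewrite (reindex (@lift_set k)) /=; last first.
  exists (@unlift_set k) => S _; [exact: lift_setK|exact: unlift_setK].
under eq_bigr => p _.
  rewrite shuffle_inv_lift_set setC_lift_set !enum_lift_set !map_cat.
  rewrite -2!map_comp /=.
  over.
rewrite -(pair_big xpredT xpredT (fun c (A : {set 'I_k}) =>
  (-1) ^+ (shuffle_inv A + ~~ c * #|A|) *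
  a ([seq v i | i <- nseq c ord0] ++ [seq (v \o lift ord0) i | i <- enum A]) *
  b ([seq v i | i <- nseq (~~ c) ord0] ++
       [seq (v \o lift ord0) i | i <- enum (~: A)]))) /=.
rewrite big_bool -[RHS]/(contract (v ord0) (a ** b) _) contract_shuffle /=.
congr (_ + _); rewrite -IH; apply: eq_bigr => A _.
  by rewrite mul0n addn0.
by rewrite /bar size_map -cardE mul1n exprD !mulrA.
Qed.

End Shuffles.

Section Map.
Variables (R : numFieldType) (T U : Type) (h : T -> U).

Lemma shuffle_map (a b : seq U -> R) s :
  (a ** b) (map h s) = ((a \o map h) ** (b \o map h)) s.
Proof.
elim: s a b => [|x s IH] a b //.
rewrite -[LHS]/(contract (h x) (a ** b) (map h s)).
rewrite -[RHS]/(contract x ((a \o map h) ** (b \o map h)) s).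
rewrite !contract_shuffle /= !IH; congr (_ + _); congr (shuffle _ _ s).
by apply/funext => t; rewrite /bar /= size_map.
Qed.

Lemma shuffle_exp_form2_map (f : U -> U -> R) s :
  shuffle_exp (form2 f) (map h s) = shuffle_exp (form2 (fun x y => f (h x) (h y))) s.
Proof.
rewrite /shuffle_exp size_map; apply: eq_bigr => j _; congr (_ * _).
move: (nat_of_ord j) => {j} m.
have -> : form2 (fun x y => f (h x) (h y)) = form2 f \o map h.
  by apply/funext => -[|x [|y [|? ?]]].
suff -> : shuffle_pow m (form2 f \o map h) = shuffle_pow m (form2 f) \o map h by [].
elim: m => [|m IH]; first by apply/funext => -[].
have powS c : shuffle_pow m.+1 c = c ** shuffle_pow m c by [].
by apply/funext => t; rewrite [RHS]/= !powS shuffle_map IH.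
Qed.

End Map.

Section Forms.
Variables (R : realType) (n : nat).
Implicit Types (a b : mform R n).

(** The bridge to the list model. The default vector 0 is never reached, as each index is below
    [size s]. *)
Definition seqf a : seq 'rV[R]_n -> R := fun s => a (size s) (fun i => nth 0 s i).

(** Comparing arguments by the values of their indices avoids casts between equal but not
    convertible degrees. *)
Lemma mform_cast a k k' (v : 'I_k -> 'rV[R]_n) (v' : 'I_k' -> 'rV[R]_n) :
  k = k' -> (forall (i : 'I_k) (i' : 'I_k'), i = i' :> nat -> v i = v' i') -> a k v = a k' v'.
Proof.
move=> kk'; subst k' => h; congr (a k _).
by apply/funext => i; apply: h.
Qed.

Lemma seqf_map a k (S : {set 'I_k}) (v : 'I_k -> 'rV[R]_n) :
  seqf a [seq v i | i <- enum S] = a #|S| (fun i => v (enum_val i)).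
Proof.
apply: mform_cast => [|i i' ii']; first by rewrite size_map -cardE.
have x0 : 'I_k by exact: (enum_val i').
rewrite (nth_map x0) ?(enum_val_nth x0) ?ii' //.
by rewrite -cardE.
Qed.

Lemma wedgeE a b k (v : 'I_k -> 'rV[R]_n) :
  wedge a b v = (seqf a ** seqf b) [seq v i | i <- enum 'I_k].
Proof.
by rewrite -shuffle_sumE; apply: eq_bigr => S _; rewrite !seqf_map.
Qed.

Lemma map_nth_ord (s : seq 'rV[R]_n) :
  [seq nth 0 s (nat_of_ord i) | i <- enum 'I_(size s)] = s.
Proof. by rewrite (map_comp (nth 0 s) val) val_enum_ord; exact: mkseq_nth. Qed.

Lemma seqf_wedge a b : seqf (wedge a b) = seqf a ** seqf b.
Proof. by apply/funext => s; rewrite {1}/seqf wedgeE map_nth_ord. Qed.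

Lemma seqf_mform2 (f : 'rV[R]_n -> 'rV[R]_n -> R) : seqf (mform2 f) = form2 f.
Proof. by apply/funext => -[|x [|y [|z s]]]. Qed.

Lemma seqf_mexp a : seqf (mexp a) = shuffle_exp (seqf a).
Proof.
apply/funext => s; rewrite {1}/seqf /mexp /shuffle_exp.
apply: eq_bigr => j _; congr (_ * _); move: (nat_of_ord j) => {j} m.
rewrite -/(seqf (iter m (wedge a) (@mform1 R n)) s).
by congr (_ s); elim: m => //= m IH; rewrite seqf_wedge IH.
Qed.

End Forms.

Lemma seqf_pullback (R : realType) m n (A : 'M[R]_(m, n)) (a : mform R n) :
  seqf (pullback A a) = seqf a \o map (mulmx^~ A).
Proof.
apply/funext => s; rewrite /= /seqf /pullback.
apply: mform_cast => [|i i' ii']; first by rewrite size_map.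
by rewrite (nth_map 0) -?ii'.
Qed.

(** The two exponentials merge into that of [om] plus the pullback of [be], whose value on the
    vectors [v] is a Pfaffian. *)
Lemma sqr_wedge_mexp (R : realType) d n (om : 'rV[R]_d -> 'rV[R]_d -> R)
    (be : 'rV[R]_n -> 'rV[R]_n -> R) (P : 'M[R]_(d, n)) (r : R)
    (psi : mform R n) (v : 'I_d -> 'rV[R]_d) :
  (forall k w, psi k w = r * @mexp R n (mform2 be) k w) ->
  (forall x y, om x y = - om y x) -> (forall x y, be x y = - be y x) ->
  wedge (mexp (mform2 om)) (pullback P psi) v ^+ 2 =
  r ^+ 2 * \det (\matrix_(i, j) (om (v i) (v j) + be (v i *m P) (v j *m P))).
Proof.
move=> psiE omN beN; rewrite wedgeE.
have -> : seqf (pullback P psi) =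
    r \*o shuffle_exp (form2 (fun x y => be (x *m P) (y *m P))).
  rewrite seqf_pullback; apply/funext => s /=.
  by rewrite {1}/seqf psiE -/(seqf _ _) seqf_mexp seqf_mform2 shuffle_exp_form2_map.
rewrite seqf_mexp seqf_mform2 shuffleZr shuffle_exp_form2D /= exprMn.
rewrite (sqr_shuffle_exp_form2 0); last by move=> u w; rewrite omN beN opprD.
congr (_ * _); rewrite /gram_det size_map size_enum_ord; congr (\det _).
have nthv (i : 'I_d) : nth 0 [seq v i | i <- enum 'I_d] i = v i.
  by rewrite (nth_map i) ?size_enum_ord // nth_ord_enum.
by apply/matrixP => i j; rewrite !mxE !nthv.
Qed.

(** * Linear algebra of the orthogonal transformation Ad *)

Section Mform2.
Variables (R : realType) (d : nat) (om : 'rV[R]_d -> 'rV[R]_d -> R).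
Hypothesis om_form : is_mform (mform2 om).

Lemma mform2_linearl v t x y : om (t *: x + y) v = t * om x v + om y v.
Proof.
have := om_form.1 2 (fun=> v) ord0 t x y.
by rewrite /= !dfwithin !dfwithout.
Qed.

Lemma mform2_linearr v t x y : om v (t *: x + y) = t * om v x + om v y.
Proof.
have := om_form.1 2 (fun=> v) ord_max t x y.
by rewrite /= !dfwithin !dfwithout.
Qed.

Lemma mform2_alt x : om x x = 0.
Proof. exact: (om_form.2 2 (fun=> x) ord0 ord_max). Qed.

Lemma mform2_anti x y : om x y = - om y x.
Proof.
have := mform2_alt (1 *: x + y).
rewrite mform2_linearl !mform2_linearr !mform2_alt !mul1r add0r addr0.
by move/eqP; rewrite addr_eq0 => /eqP.
Qed.

Lemma mform2_mx u v :
  om u v = (u *m (\matrix_(i, j) om (delta_mx 0 i) (delta_mx 0 j)) *m v^T) 0 0.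
Proof.
have om0l w : om 0 w = 0 by have := mform2_linearl w 1 0 0; rewrite scaler0 addr0 mul1r => /eqP; rewrite -subr_eq subrr eq_sym => /eqP.
have om0r w : om w 0 = 0 by rewrite mform2_anti om0l oppr0.
have suml (r : seq 'I_d) (F : 'I_d -> R) (H : 'I_d -> 'rV_d) w :
    om (\sum_(i <- r) F i *: H i) w = \sum_(i <- r) F i * om (H i) w.
  elim: r => [|i r IH]; first by rewrite !big_nil om0l.
  by rewrite !big_cons mform2_linearl IH.
have sumr (r : seq 'I_d) (F : 'I_d -> R) (H : 'I_d -> 'rV_d) w :
    om w (\sum_(i <- r) F i *: H i) = \sum_(i <- r) F i * om w (H i).
  by rewrite mform2_anti suml -sumrN; apply: eq_bigr => i _; rewrite -mulrN -mform2_anti.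
rewrite {1}(row_sum_delta u) suml {1}(row_sum_delta v).
under eq_bigr do rewrite sumr mulr_sumr.
rewrite exchange_big /= mxE; apply: eq_bigr => j _.
rewrite !mxE mulr_suml; apply: eq_bigr => i _.
by rewrite !mxE mulrAC mulrA.
Qed.

End Mform2.

Lemma mx_entry (R : pzSemiRingType) m n (X : 'M[R]_(m, n)) i j :
  ((delta_mx 0 i : 'rV_m) *m X *m (delta_mx 0 j : 'rV_n)^T) 0 0 = X i j.
Proof. by rewrite trmx_delta -rowE -colE !mxE. Qed.

Section Gram.
Variables (R : realType) (n : nat) (B : {symmetric 'rV[R]_n}).

Definition gram : 'M[R]_n := matrix_of_form B.

Lemma gramE u v : B u v = (u *m gram *m v^T) 0 0.
Proof.
rewrite -(matrix_of_formK B) /form_of_matrix -/gram [LHS]/mxtrace big_ord1.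
by congr ((_ *m _) 0 0); apply/matrixP => i j; rewrite !mxE.
Qed.

Lemma trmx_gram : gram^T = gram.
Proof. by apply/matrixP => i j; rewrite !mxE hermC expr0 mul1r. Qed.

Lemma nondegenerate_gram (w : 'rV_n) : nondegenerate B -> w *m gram = 0 -> w = 0.
Proof.
move=> /eqP nB wB; apply/eqP; rewrite -memv0 -nB.
by apply/mem_orthovP => v _; rewrite gramE wB mul0mx mxE.
Qed.

Lemma gram_ortho (A : 'M[R]_n) : (forall u v, B (u *m A) (v *m A) = B u v) ->
  A *m gram *m A^T = gram.
Proof.
move=> hA; apply/matrixP => i j.
have := hA (delta_mx 0 i) (delta_mx 0 j); rewrite !gramE.
rewrite trmx_mul !mulmxA => e.
by rewrite -[RHS]mx_entry -e -[LHS]mx_entry !mulmxA.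
Qed.

End Gram.

Section Orthogonal.
Variables (R : realType) (n d : nat) (M A : 'M[R]_n).
Hypothesis AM : A *m M *m A^T = M.

(** As 1 - A commutes with the inverse of A + 1, clearing denominators on both sides leaves (A + 1)
    M (1 - A)^T = - (1 - A) M (A + 1)^T, which follows from [AM] by expansion. *)
Lemma cayley_skew : A + 1%:M \in unitmx -> M^T = M ->
  (cayley A *m M)^T = - (cayley A *m M).
Proof.
move=> uA MT; rewrite /cayley (addrC 1%:M A).
set W := invmx _.
have AW : (A + 1%:M) *m W = 1%:M by rewrite mulmxV.
have WA : W *m (A + 1%:M) = 1%:M by rewrite mulVmx.
have cW : (1%:M - A) *m W = W *m (1%:M - A).
  have c1 : (1%:M - A) *m (A + 1%:M) = (A + 1%:M) *m (1%:M - A).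
    by rewrite !(mulmxDl, mulmxDr, mulmx1, mul1mx, mulmxN, mulNmx).
  transitivity (W *m (A + 1%:M) *m ((1%:M - A) *m W)); first by rewrite WA mul1mx.
  by rewrite -mulmxA (mulmxA (A + 1%:M)) -c1 -mulmxA AW mulmx1.
rewrite cW !trmx_mul MT.
have e : M *m (1%:M - A)^T *m W^T = - (W *m (1%:M - A) *m M).
  have h : (A + 1%:M) *m (M *m (1%:M - A)^T) = - ((1%:M - A) *m M *m (A + 1%:M)^T).
    rewrite !linearD linearN /= trmx1.
    rewrite !(mulmxDl, mulmxDr, mulmxBl, mulmxBr, mulmx1, mul1mx, mulmxN, mulNmx, mulmxA, opprK).
    rewrite AM; move: (A *m M) (M *m A^T) => X Y.
    by apply/matrixP => i j; rewrite !mxE; ring.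
  transitivity (W *m ((A + 1%:M) *m (M *m (1%:M - A)^T)) *m W^T).
    by rewrite !mulmxA WA mul1mx.
  by rewrite h mulmxN mulNmx -!mulmxA -trmx_mul WA trmx1 mulmx1.
by rewrite mulmxA e.
Qed.

Definition schur_mx (V : 'M[R]_(d, n)) (Om : 'M[R]_d) : 'M[R]_(n + d) :=
  block_mx (A + 1%:M) (- 2^-1 *: (M *m V^T)) (V *m (1%:M - A)) Om.

Lemma det_schur_mx V Om : A + 1%:M \in unitmx ->
  \det (schur_mx V Om) =
  \det (A + 1%:M) * \det (Om + 2^-1 *: (V *m cayley A *m M *m V^T)).
Proof.
move=> uA; rewrite (det_block_schur _ _ _ (mulmxV uA)); congr (_ * \det _).
rewrite -scalemxAr scaleNr opprK /cayley (addrC 1%:M A) !mulmxA.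
by [].
Qed.

(** The hypotheses say that [V] has row space the image of 1 - Ai and that [Om] is the GHJW form
    there, so a left kernel vector (w, u) can be studied through some [xi]. *)
Lemma det_schur_mx_neq0 (Ai : 'M[R]_n) (V : 'M[R]_(d, n)) (Om : 'M[R]_d) :
  A *m Ai = 1%:M -> (forall w : 'rV_n, w *m M = 0 -> w = 0) ->
  (forall u : 'rV_d, u *m V = 0 -> u = 0) ->
  (forall xi : 'rV_n, exists u : 'rV_d, u *m V = xi *m (1%:M - Ai)) ->
  (forall u : 'rV_d, exists xi : 'rV_n, u *m V = xi *m (1%:M - Ai)) ->
  (forall (u1 u2 : 'rV_d) (xi1 xi2 : 'rV_n),
    u1 *m V = xi1 *m (1%:M - Ai) -> u2 *m V = xi2 *m (1%:M - Ai) ->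
    u1 *m Om *m u2^T = - (xi1 *m (2^-1 *: (A - Ai)) *m M *m xi2^T)) ->
  \det (schur_mx V Om) != 0.
Proof.
move=> AAi M0 V0 h1 h2 hOm; have AiA := mulmx1C AAi.
rewrite -unitfE -/(is_true _) -unitmxE -row_free_unit.
apply: inj_row_free => z.
rewrite -(hsubmxK z); set w := lsubmx z; set u := rsubmx z.
rewrite mul_row_block -[0]row_mx0 => /eq_row_mx [e1 e2].
have [xi xiE] := h2 u.
have MAi : M *m Ai^T = A *m M.
  by rewrite -[in LHS]AM -!mulmxA -trmx_mul AiA trmx1 mulmx1.
have MAi' : M *m (1%:M - Ai)^T = (1%:M - A) *m M.
  by rewrite linearB /= trmx1 mulmxBr mulmx1 MAi mulmxBl mul1mx.
(* The second block equation is paired with arbitrary [u2], hence with arbitrary [eta];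
   nondegeneracy of [M] then yields an identity of vectors. *)
have e3 : w *m (1%:M - A) + xi *m (A - Ai) = 0.
  apply: M0; set X := (X in X = 0).
  suff X0 (eta : 'rV[R]_n) : X *m eta^T = 0.
    apply/rowP => j; have /matrixP /(_ 0 0) := X0 (delta_mx 0 j).
    by rewrite trmx_delta -colE !mxE.
  have [u2 u2E] := h1 eta.
  have /(congr1 (mulmx^~ u2^T)) := e2.
  rewrite mulmxDl mul0mx (hOm _ _ _ _ xiE u2E).
  have -> : w *m (- 2^-1 *: (M *m V^T)) *m u2^T =
      - 2^-1 *: (w *m (1%:M - A) *m M *m eta^T).
    rewrite -scalemxAr -scalemxAl; congr (_ *: _).
    rewrite -!mulmxA -trmx_mul u2E trmx_mul (mulmxA M) MAi' -!mulmxA.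
    by [].
  rewrite -[in X in _ - X]scalemxAr -!scalemxAl scaleNr -opprD -scalerDr.
  move/eqP; rewrite oppr_eq0 scaler_eq0 invr_eq0 pnatr_eq0 /= => /eqP.
  by rewrite -!mulmxDl.
(* The first block equation plus [e3] isolates 2w, because (1 - Ai)(1 - A) + (A - Ai) = 2(1 -
   Ai). *)
have wE : w = - (xi *m (1%:M - Ai)).
  have e4 : w *m (A + 1%:M) = - (xi *m (1%:M - Ai) *m (1%:M - A)).
    by apply/eqP; rewrite -addr_eq0 -xiE -mulmxA e1.
  apply: (@scalerI _ _ (2 : R)); first by rewrite pnatr_eq0.
  have -> : 2 *: w = w *m (A + 1%:M) + w *m (1%:M - A).
    by rewrite -mulmxDr addrC addrA subrK mulmxDr mulmx1 scaler_nat mulr2n.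
  rewrite e4 (_ : w *m (1%:M - A) = - (xi *m (A - Ai))); last first.
    by apply/eqP; rewrite -addr_eq0 e3.
  rewrite -opprD -mulmxA -mulmxDr scalerN scalemxAr; congr (- (_ *m _)).
  rewrite mulmxBl mul1mx mulmxBr mulmx1 AiA.
  by apply/matrixP => i j; rewrite !mxE; ring.
(* Putting w = -x into w (A + 1) + x (1 - A) = 0 leaves -2 x A = 0. *)
have xA : (xi *m (1%:M - Ai)) *m A = 0.
  move: e1; rewrite wE mulmxA xiE; set x := xi *m _.
  rewrite mulmxDr mulmxBr !mulmx1 !mulNmx addrA subrK -opprD.
  by move/eqP; rewrite oppr_eq0 -mulr2n -scaler_nat scaler_eq0 pnatr_eq0 /= => /eqP.
have x0 : xi *m (1%:M - Ai) = 0.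
  transitivity (xi *m (1%:M - Ai) *m A *m Ai); last by rewrite xA mul0mx.
  by rewrite -[RHS]mulmxA AAi mulmx1.
have u0 : u = 0 by apply: V0; rewrite xiE x0.
by rewrite wE x0 oppr0 u0 row_mx0.
Qed.

End Orthogonal.

Local Open Scope classical_set_scope.

(** * Matrix coefficients of representations *)

(** A path starting in [H] has connected image, so it cannot leave a clopen set. *)
Lemma simply_connected_clopen (R : realType) (T : topologicalType) (H : set T) :
  simply_connected R T -> open H -> closed H -> H !=set0 -> H = setT.
Proof.
move=> [pc _] oH cH [x Hx]; apply/seteqP; split=> // y _.
have [f [fc f0 f1]] := pc x y.
have cA : connected (f @` `[0, 1]).
  by apply: connected_continuous_connected => //; exact: segment_connected.
have : (f @` `[0, 1]) `&` H = f @` `[0, 1].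
  apply: cA; [|by exists H|by exists H].
  by exists x; split => //; exists 0 => //; rewrite /= in_itv /= lexx ler01.
move=> /seteqP [_ /(_ y)] [] //.
by exists 1 => //; rewrite /= in_itv /= lexx ler01.
Qed.

Section TensorPower.
Variable R : comNzRingType.

(** The Kronecker power, in bases indexed by functions on ['I_k]. *)
Definition tensor_mx k m p (X : 'M[R]_(m, p)) :
    'M[R]_(#|{ffun 'I_k -> 'I_m}|, #|{ffun 'I_k -> 'I_p}|) :=
  \matrix_(i, j) \prod_l X ((enum_val i : {ffun 'I_k -> 'I_m}) l) ((enum_val j : {ffun 'I_k -> 'I_p}) l).

Lemma tensor_mxM k m p q (X : 'M[R]_(m, p)) (Y : 'M[R]_(p, q)) :
  tensor_mx k (X *m Y) = tensor_mx k X *m tensor_mx k Y.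
Proof.
apply/matrixP => i j; rewrite !mxE.
under eq_bigr => l _ do rewrite mxE.
rewrite (bigA_distr_bigA (fun l c => X ((enum_val i : {ffun 'I_k -> 'I_m}) l) c *
  Y c ((enum_val j : {ffun 'I_k -> 'I_q}) l))).
rewrite (reindex (@enum_val {ffun 'I_k -> 'I_p} predT)) /=; last first.
  by apply: onW_bij; exact: enum_val_bij.
by apply: eq_bigr => c _; rewrite !mxE big_split.
Qed.

(** The Leibniz formula: the row of the identity function lists products of entries of [X], and [c]
    selects the permutations with their signs. *)
Lemma det_tensor_mx n : exists (r : 'I__) (c : 'cV[R]__),
  forall X : 'M[R]_n, \det X = (row r (tensor_mx n X) *m c) 0 0.
Proof.
exists (enum_rank [ffun i => i]).
exists (\col_j \sum_(s : 'S_n) (-1) ^+ s * (enum_val j == [ffun i => s i])%:R).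
move=> X; rewrite mxE.
under eq_bigr => j _ do rewrite !mxE mulr_sumr.
rewrite exchange_big /=; apply: eq_bigr => s _.
rewrite (bigD1 (enum_rank [ffun i => s i])) //= !enum_rankK eqxx mulr1.
rewrite [X in _ + X]big1.
  rewrite addr0 mulrC; congr (_ * _); apply: eq_bigr => l _.
  by rewrite !ffunE.
move=> j jN; rewrite (negPf (_ : enum_val j != _)) ?mulr0 //.
by apply: contraNneq jN => <-; rewrite enum_valK.
Qed.

End TensorPower.

Section MatrixCoefficients.
Variables (R : realType) (G : topGroupType).
Hypothesis mulc : continuous (fun gh : G * G => (gh.1 * gh.2)%g).
Hypothesis invc : continuous (fun g : G => g^-1%g).
Hypothesis scG : simply_connected R G.

Lemma mulg_continuous (g h : G) : {for h, continuous (fun x : G => (g * x)%g)}.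
Proof.
apply: (@continuous_comp _ _ _ (fun x => (g, x)) (fun gh : G * G => (gh.1 * gh.2)%g)).
  by apply: cvg_pair; [exact: cvg_cst|exact: cvg_id].
exact: mulc.
Qed.

Lemma mulg_continuousr (g h : G) : {for h, continuous (fun x : G => (x * g)%g)}.
Proof.
apply: (@continuous_comp _ _ _ (fun x => (x, g)) (fun gh : G * G => (gh.1 * gh.2)%g)).
  by apply: cvg_pair; [exact: cvg_id|exact: cvg_cst].
exact: mulc.
Qed.

(* The smallest subspace U containing v rho(g) for all g close to 1 is stable
   under rho(h) for h close to 1, hence under the whole connected group. *)
Lemma matrix_coef_near0 N (rho : G -> 'M[R]_N) (v : 'rV_N) (c : 'cV_N) (g0 : G) :
  (forall g h, rho (g * h)%g = rho h *m rho g) ->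
  (\forall g \near g0, v *m rho g *m c = 0) ->
  forall g, v *m rho g *m c = 0.
Proof.
move=> rhoM near0.
pose good (U : 'M[R]_N) := \forall g \near (1%g : G), (v *m rho g <= U)%MS.
(* A good subspace of least rank is the smallest one, since good subspaces are stable under
   intersection. *)
have exU : exists k, `[< exists2 U, good U & \rank U = k >].
  exists (\rank (1%:M : 'M[R]_N)); apply/asboolP; exists 1%:M => //.
  by apply: nearW => g; exact: submx1.
have [k /asboolP [U gU rU] kmin] := ex_minnP exU.
have Umin U' : good U' -> (U <= U')%MS.
  move=> gU'; have gI : good (U :&: U')%MS.
    by near=> g; rewrite sub_capmx; apply/andP; split; near: g.
  have rI : (\rank U <= \rank (U :&: U')%MS)%N.
    by rewrite rU; apply: kmin; apply/asboolP; exists (U :&: U')%MS.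
  have := mxrank_leqif_sup (capmxSl U U') => -[_].
  rewrite eqn_leq rI (mxrankS (capmxSl _ _)) /= => /esym.
  by move=> h; apply: submx_trans h (capmxSr _ _).
pose H := [set h | (U *m rho h <= U)%MS].
have nearH : \forall h \near (1%g : G), H h.
  have := @mulc (1%g, 1%g); rewrite /= => /(_ [set g | (v *m rho g <= U)%MS]).
  rewrite mulg1 => /(_ gU) [[A B] /= [A1 B1] AB].
  near=> h; have Ah : A h by near: h.
  (* The preimage of [U] under [rho h], written as a kernel, is good; by minimality it contains
     [U]. *)
  have : good (kermx (rho h *m cokermx U)).
    near=> g; apply/sub_kermxP; rewrite mulmxA -(mulmxA v) -rhoM.
    apply/eqP; rewrite -submxE.
    by apply: (AB (h, g)); split => //=; near: g.
  by move=> /Umin /sub_kermxP /eqP; rewrite mulmxA -submxE.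
have mulH g h : H g -> H h -> H (g * h)%g.
  rewrite /H /= rhoM mulmxA => Hg Hh.
  by apply: submx_trans Hg; apply: submxMr.
(* [H] is stable under products and contains a neighbourhood of 1; translating that neighbourhood
   shows that [H] and its complement are open. *)
have HT : H = setT.
  apply: (simply_connected_clopen scG); last first.
  - by exists 1%g; exact: nbhs_singleton.
  - rewrite -[H]setCK; apply: open_closedC; rewrite openE => h0 Hh0.
    have c1 : (fun h : G => (h0 * h^-1)%g) @ h0 --> (1%g : G).
      rewrite -(mulgV h0).
      suff : {for h0, continuous ((fun x : G => (h0 * x)%g) \o (fun x : G => x^-1%g))}.
        by [].
      by apply: continuous_comp; [exact: invc|exact: mulg_continuous].
    have c2 : \forall h \near h0, H (h0 * h^-1)%g by exact: (c1 _ nearH).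
    rewrite /interior /=; apply: filterS c2 => h /= Hh Hh'.
    apply: Hh0; suff : H (h0 * h^-1 * h)%g by rewrite mulgKV.
    exact: mulH.
  - rewrite openE => h0 Hh0.
    have c1 : (fun h : G => (h * h0^-1)%g) @ h0 --> (1%g : G).
      by rewrite -(mulgV h0); exact: mulg_continuousr.
    have c2 : \forall h \near h0, H (h * h0^-1)%g by exact: (c1 _ nearH).
    rewrite /interior /=; apply: filterS c2 => h /= Hh.
    suff : H (h * h0^-1 * h0)%g by rewrite mulgKV.
    exact: mulH.
have allU g : (v *m rho g <= U)%MS.
  have v1 : (v *m rho 1%g <= U)%MS by exact: (nbhs_singleton gU).
  have Hg : H g by rewrite HT.
  rewrite -[g]mulg1 rhoM mulmxA; apply: submx_trans Hg.
  exact: submxMr.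
(* Translating the hypothesis from [g0] to 1 makes the kernel of [rho g0 *m c] good, so it contains
   [U]. *)
have /Umin/sub_kermxP Uc : good (kermx (rho g0 *m c)).
  have c1 : (fun h : G => (g0 * h)%g) @ (1%g : G) --> g0.
    by rewrite -[X in _ --> X]mulg1; exact: mulg_continuous.
  have c2 : \forall h \near (1%g : G), v *m rho (g0 * h)%g *m c = 0 by exact: (c1 _ near0).
  apply: filterS c2 => h /= Hh.
  by apply/sub_kermxP; rewrite mulmxA -(mulmxA v) -rhoM.
move=> g; rewrite -(mulKVg g0 g) rhoM mulmxA.
have /submxP [w ->] := allU (g0^-1 * g)%g.
by rewrite -!mulmxA Uc mulmx0.
Unshelve. all: by end_near. Qed.

Lemma det_add1_near n (A : G -> 'M[R]_n) (g0 : G) :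
  (forall g h, A (g * h)%g = A h *m A g) -> A 1%g = 1%:M ->
  ~ (\forall g \near g0, \det (A g + 1%:M) = 0).
Proof.
move=> AM A1 near0.
have [r [c detE]] := det_tensor_mx R n.
(* Since [A g + 1%:M = R1 *m Bl g *m C1], multiplicativity of the tensor power turns the determinant
   into a coefficient of the tensor power of [Bl]. *)
pose Bl g : 'M[R]_(n + n) := block_mx 1%:M 0 0 (A g).
pose R1 : 'M[R]_(n, n + n) := row_mx 1%:M 1%:M.
pose C1 : 'M[R]_(n + n, n) := col_mx 1%:M 1%:M.
have dE g : \det (A g + 1%:M) =
    (row r (tensor_mx n R1) *m tensor_mx n (Bl g) *m (tensor_mx n C1 *m c)) 0 0.
  rewrite !mulmxA -2!row_mul -!tensor_mxM -detE; congr (\det _).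
  rewrite mul_row_block mul_row_col !mulmx1 !mulmx0 addr0 add0r.
  by rewrite !mul1mx addrC.
have /(_ 1%g) : forall g, row r (tensor_mx n R1) *m tensor_mx n (Bl g) *m (tensor_mx n C1 *m c) = 0.
  apply: (@matrix_coef_near0 _ _ _ _ g0) => [g h|].
    by rewrite -tensor_mxM mulmx_block !(mulmx0, mul0mx, mulmx1, addr0, add0r) -AM.
  by apply: filterS near0 => g; rewrite dE => h; apply/matrixP => i j; rewrite !ord1 h mxE.
(* At the identity the coefficient is the determinant of 2, which is nonzero. *)
move=> /matrixP /(_ 0 0); rewrite -dE A1 mxE => /eqP.
rewrite (_ : 1%:M + 1%:M = 2%:M); last by rewrite -raddfD.
by rewrite det_scalar expf_eq0 pnatr_eq0 andbF.
Qed.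

End MatrixCoefficients.

(** * Jacobians in charts *)

Section Derivatives.
Variables (R : realType).

Lemma near_eq_diff (V W : normedModType R) (f g : V -> W) (x : V) :
  (\forall y \near x, f y = g y) -> differentiable f x ->
  differentiable g x /\ 'd g x = 'd f x :> (V -> W).
Proof.
move=> fg df.
have gdf : g \o shift x = cst (g x) + 'd f x +o_ 0 id.
  have gx : g x = f x by apply/esym/(nbhs_singleton fg).
  have /eqaddoP h := diff_locally df.
  apply/eqaddoP => e e0; have h0 := h e e0.
  have sh : \forall y \near (0 : V), f (y + x) = g (y + x).
    have c : (fun y : V => y + x) @ (0 : V) --> x.
      rewrite -[X in _ --> X]add0r.
      by apply: cvgD; [exact: cvg_id|exact: cvg_cst].
    exact: (c _ fg).
  near=> y; rewrite gx.
  have -> : (g \o shift x - (cst (f x) + 'd f x)) y = (f \o shift x - (cst (f x) + 'd f x)) y.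
    congr (_ - _); rewrite /=; apply/esym; near: y; exact: sh.
  by near: y.
have dg := diff_unique (diff_continuous df) gdf.
by split => //; apply/diff_locallyP; rewrite dg; split => //; exact: diff_continuous.
Unshelve. all: by end_near. Qed.

Lemma mul_jacobian n m (f : 'rV[R]_n -> 'rV[R]_m) x (u : 'rV[R]_n) :
  u *m ('J f x : 'M[R]_(n, m)) = 'd f x u.
Proof. by rewrite /jacobian mul_rV_lin1. Qed.

Lemma mulmx_rowI n m (A B : 'M[R]_(n, m)) :
  (forall u : 'rV_n, u *m A = u *m B) -> A = B.
Proof. by move=> h; apply/row_matrixP => i; rewrite !rowE h. Qed.

Lemma near_eq_jacobian n m (f g : 'rV[R]_n -> 'rV[R]_m) x :
  (\forall y \near x, f y = g y) -> differentiable f x -> 'J g x = 'J f x.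
Proof.
move=> fg df; apply: mulmx_rowI => u; rewrite [LHS]mul_jacobian [RHS]mul_jacobian.
have [_ e] := near_eq_diff fg df.
exact: (congr1 (fun h => h u) e).
Qed.

Lemma jacobian_comp n m p (f : 'rV[R]_n -> 'rV[R]_m) (g : 'rV[R]_m -> 'rV[R]_p) x y :
  f x = y -> differentiable f x -> differentiable g y ->
  'J (g \o f) x = ('J f x : 'M[R]_(n, m)) *m ('J g y : 'M[R]_(m, p)).
Proof.
move=> <- df dg; apply: mulmx_rowI => u.
rewrite mulmxA [X in _ = X *m _]mul_jacobian [LHS]mul_jacobian [RHS]mul_jacobian.
by rewrite diff_comp.
Qed.

Lemma jacobian_id n (x : 'rV[R]_n) : 'J id x = 1%:M.
Proof.
apply: mulmx_rowI => u; rewrite mul_jacobian mulmx1.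
by have /(congr1 (@^~ u)) := @diff_val _ _ _ _ _ _ _ (is_diff_id x).
Qed.

End Derivatives.

Section Charts.
Variables (R : realType) (M N P : topologicalType) (m n p : nat).

(** Near [c x] the values of [f] stay in the source of [c'], so inserting [c'] and its inverse
    changes nothing and the usual chain rule applies. *)
Lemma chart_comp (c : chart R M m) (c' : chart R N n) (c'' : chart R P p)
    (f : M -> N) (g : N -> P) x :
  source c x -> source c' (f x) -> {for x, continuous f} ->
  differentiable (c' \o f \o coord_inv c) (c x) ->
  differentiable (c'' \o g \o coord_inv c') (c' (f x)) ->
  differentiable (c'' \o (g \o f) \o coord_inv c) (c x) /\
  'J (c'' \o (g \o f) \o coord_inv c) (c x) =
    'J (c' \o f \o coord_inv c) (c x) *m
    'J (c'' \o g \o coord_inv c') (c' (f x)).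
Proof.
move=> sx sfx fc df dg.
have e0 : (c' \o f \o coord_inv c) (c x) = c' (f x) by rewrite /= coordK.
have near_eq : \forall y \near c x,
   ((c'' \o g \o coord_inv c') \o (c' \o f \o coord_inv c)) y =
   (c'' \o (g \o f) \o coord_inv c) y.
  have cc : {for c x, continuous (f \o coord_inv c)}.
    apply: continuous_comp; first exact/coord_inv_continuous/coord_target.
    by rewrite coordK.
  have : \forall y \near c x, source c' (f (coord_inv c y)).
    apply: cc; rewrite /= coordK //.
    by apply: open_nbhs_nbhs; split => //; exact: open_source.
  by apply: filterS => y /= sy; rewrite coordK.
have dgf : differentiable ((c'' \o g \o coord_inv c') \o (c' \o f \o coord_inv c)) (c x).
  by apply: differentiable_comp => //; rewrite e0.
split; first by have [] := near_eq_diff near_eq dgf.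
transitivity ('J ((c'' \o g \o coord_inv c') \o (c' \o f \o coord_inv c)) (c x)).
  exact: near_eq_jacobian.
exact: jacobian_comp.
Qed.

Lemma smooth_map_differentiable (SM : manifold R M m) (SN : manifold R N n) f c c' x :
  smooth_map SM SN f -> atlas SM c -> atlas SN c' -> source c x -> source c' (f x) ->
  differentiable (c' \o f \o coord_inv c) (c x).
Proof.
move=> [_ sm] ac ac' sx sfx; have [+ _] := sm _ _ ac ac' 1%N; apply; split.
  exact: coord_target.
by rewrite /= coordK.
Qed.

End Charts.

(** As a relation satisfied by at most one matrix, it turns identities between maps into identities
    between matrices, in any charts. *)
Definition is_jac (R : realType) (M N : topologicalType) m n (c : chart R M m)
    (c' : chart R N n) (f : M -> N) (x : M) (A : 'M[R]_(m, n)) : Prop :=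
  differentiable (c' \o f \o coord_inv c) (c x) /\
  'J (c' \o f \o coord_inv c) (c x) = A.

Section IsJac.
Variables (R : realType) (M N P : topologicalType) (m n p : nat).

Lemma is_jac_unique (c : chart R M m) (c' : chart R N n) f x A B :
  is_jac c c' f x A -> is_jac c c' f x B -> A = B.
Proof. by move=> [_ <-] [_ <-]. Qed.

(** The composite [k] and the point [y] are separate variables, so that equations such as
    [g * 1 = g] need not be rewritten inside a chart. *)
Lemma is_jac_comp (c : chart R M m) (c' : chart R N n) (c'' : chart R P p)
    (f : M -> N) (g : N -> P) (k : M -> P) x y A B :
  (forall z, g (f z) = k z) ->
  source c x -> source c' y -> f x = y -> {for x, continuous f} ->
  is_jac c c' f x A -> is_jac c' c'' g y B -> is_jac c c'' k x (A *m B).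
Proof.
move=> gfk sx sy fxy fc [df <-] [dg <-]; subst y.
have [d e] := chart_comp sx sy fc df dg.
have -> : k = g \o f by apply/funext => z; rewrite -gfk.
by [].
Qed.

Lemma is_jac_id (c : chart R M m) x : source c x -> is_jac c c id x 1%:M.
Proof.
move=> sx; rewrite /is_jac.
have near_eq : \forall y \near c x, y = (c \o id \o coord_inv c) y.
  have : \forall y \near c x, target c y.
    apply: open_nbhs_nbhs; split; [exact: open_target|exact: coord_target].
  by apply: filterS => y ty /=; rewrite coord_invK.
have did : differentiable (id : 'rV[R]_m -> 'rV[R]_m) (c x).
  exact: (@ex_diff _ _ _ _ _ _ _ (is_diff_id _)).
have [d _] := near_eq_diff near_eq did.
split=> //; transitivity ('J (id : 'rV[R]_m -> 'rV[R]_m) (c x)); last exact: jacobian_id.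
exact: near_eq_jacobian.
Qed.

Lemma is_jac_tangent_map (SM : manifold R M m) (SN : manifold R N n) f x :
  smooth_map SM SN f ->
  is_jac (chart_at SM x) (chart_at SN (f x)) f x (tangent_map SM SN f x).
Proof.
move=> sf; split=> //.
by apply: (smooth_map_differentiable sf);
  do ?[exact: chart_at_atlas|exact: chart_at_source].
Qed.

End IsJac.

Section Partial.
Variables (R : realType) (U V W : normedModType R).

Lemma diff_partial1 (F : U * V -> W) x y : differentiable F (x, y) ->
  differentiable (fun a => F (a, y)) x /\
  forall u, 'd (fun a => F (a, y)) x u = 'd F (x, y) (u, 0).
Proof.
move=> dF.
have ip : is_diff x (fun a : U => (a, y)) (fun a => (a, 0)).
  exact: (@is_diff_pair _ _ _ _ id id (cst y) 0 x).
have dp := @ex_diff _ _ _ _ _ _ _ ip.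
have dc : differentiable (F \o (fun a : U => (a, y))) x.
  exact: differentiable_comp.
split=> // u; have /(congr1 (@^~ u)) /= := diff_comp dp dF.
by move=> ->; rewrite [X in 'd _ _ (X u)](@diff_val _ _ _ _ _ _ _ ip).
Qed.

Lemma diff_partial2 (F : U * V -> W) x y : differentiable F (x, y) ->
  differentiable (fun b => F (x, b)) y /\
  forall u, 'd (fun b => F (x, b)) y u = 'd F (x, y) (0, u).
Proof.
move=> dF.
have ip : is_diff y (fun b : V => (x, b)) (fun b => (0, b)).
  exact: (@is_diff_pair _ _ _ _ (cst x) 0 id id y).
have dp := @ex_diff _ _ _ _ _ _ _ ip.
have dc : differentiable (F \o (fun b : V => (x, b))) y.
  exact: differentiable_comp.
split=> // u; have /(congr1 (@^~ u)) /= := diff_comp dp dF.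
by move=> ->; rewrite [X in 'd _ _ (X u)](@diff_val _ _ _ _ _ _ _ ip).
Qed.

End Partial.

(** * Lie groups *)

Section LieGroup.
Variables (R : realType) (G : topGroupType) (n : nat) (LG : lie_group R G n).

Local Notation ch := (chart_at LG).

Definition chart_mul (c c' c'' : chart R G n) (xy : 'rV[R]_n * 'rV[R]_n) : 'rV[R]_n :=
  c'' (coord_inv c xy.1 * coord_inv c' xy.2)%g.

Section ChartMul.
Variables (c c' c'' : chart R G n) (g h : G).
Hypotheses (ac : atlas LG c) (ac' : atlas LG c') (ac'' : atlas LG c'').
Hypotheses (sg : source c g) (sh : source c' h) (sgh : source c'' (g * h)%g).

Lemma differentiable_chart_mul : differentiable (chart_mul c c' c'') (c g, c' h).
Proof.
have [+ _] := lie_mul_smooth ac ac' ac'' 1%N; apply.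
by split => /=; rewrite ?coordK //; exact: coord_target.
Qed.

Lemma derive_chart_mul_continuous v :
  {for (c g, c' h), continuous ('D_v (chart_mul c c' c''))}.
Proof.
have [_ /(_ v)] := lie_mul_smooth ac ac' ac'' 1%N; apply.
by split => /=; rewrite ?coordK //; exact: coord_target.
Qed.

(** A translation is the multiplication with one argument frozen, so its differential is a partial
    derivative of a smooth map. *)
Lemma jac_lmul :
  is_jac c' c'' (fun x : G => (g * x)%g) h
    ('J (c'' \o (fun x : G => (g * x)%g) \o coord_inv c') (c' h)) /\
  forall u, 'd (c'' \o (fun x : G => (g * x)%g) \o coord_inv c') (c' h) u =
            'd (chart_mul c c' c'') (c g, c' h) (0, u).
Proof.
have := diff_partial2 differentiable_chart_mul.
have -> : (fun b => chart_mul c c' c'' (c g, b)) =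
          c'' \o (fun x : G => (g * x)%g) \o coord_inv c'.
  by apply/funext => b; rewrite /chart_mul /= coordK.
by move=> [d e]; split.
Qed.

Lemma jac_rmul :
  is_jac c c'' (fun x : G => (x * h)%g) g
    ('J (c'' \o (fun x : G => (x * h)%g) \o coord_inv c) (c g)) /\
  forall u, 'd (c'' \o (fun x : G => (x * h)%g) \o coord_inv c) (c g) u =
            'd (chart_mul c c' c'') (c g, c' h) (u, 0).
Proof.
have := diff_partial1 differentiable_chart_mul.
have -> : (fun b => chart_mul c c' c'' (b, c' h)) =
          c'' \o (fun x : G => (x * h)%g) \o coord_inv c.
  by apply/funext => b; rewrite /chart_mul /= coordK.
by move=> [d e]; split.
Qed.

End ChartMul.

Lemma lmul_continuous (g h : G) : {for h, continuous (fun x : G => (g * x)%g)}.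
Proof. exact: mulg_continuous (lie_mul_continuous LG) g h. Qed.

Lemma rmul_continuous (g h : G) : {for h, continuous (fun x : G => (x * g)%g)}.
Proof. exact: mulg_continuousr (lie_mul_continuous LG) g h. Qed.

Lemma ch_atlas g : atlas LG (ch g). Proof. exact: chart_at_atlas. Qed.
Lemma ch_source g : source (ch g) g. Proof. exact: chart_at_source. Qed.
Hint Resolve ch_atlas ch_source : core.

Lemma is_jac_left g h k : (g * h)%g = k ->
  is_jac (ch h) (ch k) (fun x : G => (g * x)%g) h (left_translation_map LG g h).
Proof. by move=> <-; have [] := @jac_lmul (ch g) (ch h) (ch (g * h)%g) g h. Qed.

Lemma is_jac_right g h k : (h * g)%g = k ->
  is_jac (ch h) (ch k) (fun x : G => (x * g)%g) h (right_translation_map LG g h).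
Proof. by move=> <-; have [] := @jac_rmul (ch h) (ch g) (ch (h * g)%g) h g. Qed.

Lemma conjugation1 (g : G) : conjugation g 1%g = 1%g.
Proof. by rewrite /conjugation mulg1 mulgV. Qed.

Lemma is_jac_conj g h k : conjugation g h = k ->
  is_jac (ch h) (ch k) (conjugation g) h (conjugation_map LG g h).
Proof.
move=> <-; split => //.
have l1 := is_jac_left (erefl (g * h)%g).
have r1 := is_jac_right (erefl (g * h * g^-1)%g).
have := is_jac_comp (k := conjugation g) _ (ch_source h) (ch_source (g * h)%g)
  (erefl _) (@lmul_continuous g h) l1 r1.
by move=> /(_ (fun=> erefl _)) [].
Qed.

Lemma is_jac_Ad g : is_jac (ch 1%g) (ch 1%g) (conjugation g) 1%g (Ad LG g).
Proof. exact: is_jac_conj (conjugation1 g). Qed.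

Lemma conj_continuous (g h : G) : {for h, continuous (conjugation g)}.
Proof.
apply: (@continuous_comp _ _ _ (fun x : G => (g * x)%g) (fun x : G => (x * g^-1)%g)).
  exact: lmul_continuous.
exact: rmul_continuous.
Qed.

(** The order is reversed because matrices act on row vectors from the right. *)
Lemma Ad_mul g h : Ad LG (g * h)%g = Ad LG h *m Ad LG g.
Proof.
apply: is_jac_unique (is_jac_Ad _) _.
apply: is_jac_comp (ch_source 1%g) (ch_source 1%g) (conjugation1 h)
  (@conj_continuous h 1%g) (is_jac_Ad h) (is_jac_Ad g) => x.
by rewrite /conjugation invgM !mulgA.
Qed.

Lemma Ad_one : Ad LG 1%g = 1%:M.
Proof.
apply: is_jac_unique (is_jac_id (ch_source 1%g)).
have [d e] := is_jac_Ad 1%g.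
have := is_jac_comp (k := id) _ (ch_source 1%g) (ch_source 1%g) (conjugation1 1%g)
  (@conj_continuous 1%g 1%g) (is_jac_Ad 1%g) (is_jac_id (ch_source 1%g)).
rewrite mulmx1; apply=> x.
by rewrite /conjugation mul1g invg1 mulg1.
Qed.

(* The derivatives at 1 of y |-> g y and y |-> y g, where g has coordinates x;
   unlike the translation maps they refer to a fixed chart c, which makes them
   continuous in x. *)
Definition lmul_jac (c : chart R G n) (x : 'rV[R]_n) : 'M[R]_n :=
  'J (c \o (fun y : G => (coord_inv c x * y)%g) \o coord_inv (ch 1%g)) (ch 1%g 1%g).
Definition rmul_jac (c : chart R G n) (x : 'rV[R]_n) : 'M[R]_n :=
  'J (c \o (fun y : G => (y * coord_inv c x)%g) \o coord_inv (ch 1%g)) (ch 1%g 1%g).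

Section Frame.
Variables (c : chart R G n) (g : G).
Hypotheses (ac : atlas LG c) (sg : source c g).

Lemma is_jac_lmul_jac : is_jac (ch 1%g) c (fun x : G => (g * x)%g) 1%g (lmul_jac c (c g)).
Proof.
rewrite /lmul_jac coordK //.
have s1 : source c (g * 1)%g by rewrite mulg1.
exact: (jac_lmul ac (ch_atlas 1%g) ac sg (ch_source 1%g) s1).1.
Qed.

Lemma is_jac_rmul_jac : is_jac (ch 1%g) c (fun x : G => (x * g)%g) 1%g (rmul_jac c (c g)).
Proof.
rewrite /rmul_jac coordK //.
have s1 : source c (1 * g)%g by rewrite mul1g.
exact: (jac_rmul (ch_atlas 1%g) ac ac (ch_source 1%g) sg s1).1.
Qed.

(** The identity is left translation by 1, which gives differentiability of the change of chart. *)
Lemma is_jac_frame : is_jac c (ch g) id g (coord_frame LG c (c g)).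
Proof.
have s1 : source (ch g) (1 * g)%g by rewrite mul1g.
have l1 := (jac_lmul (ch_atlas 1%g) ac (ch_atlas g) (ch_source 1%g) sg s1).1.
have := is_jac_comp (k := id) _ sg (ch_source g) (mul1g g) (@lmul_continuous 1%g g)
  l1 (is_jac_id (ch_source g)).
move=> /(_ (@mul1g _)) [d _]; split; first exact: d.
rewrite /coord_frame; move: (coord_inv c (c g)) (coordK sg) => k ->.
by have -> : ch g \o id \o coord_inv c = ch g \o coord_inv c by apply/funext.
Qed.

Lemma is_jac_from_frame k A : is_jac (ch g) (ch 1%g) k g A -> is_jac c (ch 1%g) k g
  (coord_frame LG c (c g) *m A).
Proof.
move=> kA; have idc : {for g, continuous (@id G)} by exact: cvg_id.
exact: (is_jac_comp (fun z => erefl (k z)) sg (ch_source g) (erefl g) idc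
  is_jac_frame kA).
Qed.

Lemma lmul_jacK : lmul_jac c (c g) *m
  (coord_frame LG c (c g) *m left_translation_map LG g^-1%g g) = 1%:M.
Proof.
apply: is_jac_unique (is_jac_id (ch_source 1%g)).
apply: is_jac_comp (ch_source 1%g) sg (mulg1 g) (@lmul_continuous g 1%g)
  is_jac_lmul_jac (is_jac_from_frame (is_jac_left (mulVg g))) => x.
by rewrite mulKg.
Qed.

Lemma rmul_jac_unit : rmul_jac c (c g) \in unitmx.
Proof.
suff /mulmx1_unit[] : rmul_jac c (c g) *m
  (coord_frame LG c (c g) *m right_translation_map LG g^-1%g g) = 1%:M by [].
apply: is_jac_unique (is_jac_id (ch_source 1%g)).
apply: is_jac_comp (ch_source 1%g) sg (mul1g g) (@rmul_continuous g 1%g)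
  is_jac_rmul_jac (is_jac_from_frame (is_jac_right (mulgV g))) => x.
by rewrite mulgK.
Qed.

(** The derivative at 1 of [conjugation g x * g = g * x]; it expresses [Ad] through matrices that
    are continuous in coordinates. *)
Lemma Ad_rmul_jac : Ad LG g *m rmul_jac c (c g) = lmul_jac c (c g).
Proof.
apply: is_jac_unique is_jac_lmul_jac.
apply: is_jac_comp (ch_source 1%g) (ch_source 1%g) (conjugation1 g)
  (@conj_continuous g 1%g) (is_jac_Ad g) is_jac_rmul_jac => x.
by rewrite /conjugation mulgKV.
Qed.

End Frame.
End LieGroup.

Lemma near_eq_continuous (T U : topologicalType) (f g : T -> U) x :
  (\forall y \near x, f y = g y) -> {for x, continuous f} -> {for x, continuous g}.
Proof.
move=> fg fc; have fgx := nbhs_singleton fg.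
rewrite /prop_for /continuous_at -fgx.
by apply: cvg_trans fc; apply: near_eq_cvg; apply: filterS fg => y ->.
Qed.

Lemma diff_diag (R : realType) (U V W : normedModType R) (F : U * V -> W)
    (q : V -> U) y : differentiable F (q y, y) -> differentiable q y ->
  differentiable (fun b => F (q b, b)) y /\
  forall u, 'd (fun b => F (q b, b)) y u =
    'd (fun a => F (a, y)) (q y) ('d q y u) + 'd (fun b => F (q y, b)) y u.
Proof.
move=> dF dq.
have ip : is_diff y (fun b : V => (q b, b)) (fun b => ('d q y b, b)).
  exact: (@is_diff_pair _ _ _ _ q ('d q y) id id y (differentiableP dq)).
have dp := @ex_diff _ _ _ _ _ _ _ ip.
have dc : differentiable (F \o (fun b : V => (q b, b))) y.
  exact: differentiable_comp.
split=> // u; have /(congr1 (@^~ u)) /= := diff_comp dp dF.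
move=> ->; rewrite [X in 'd _ _ (X u)](@diff_val _ _ _ _ _ _ _ ip).
have [_ ->] := diff_partial1 dF; have [_ ->] := diff_partial2 dF.
by rewrite -linearD /=; congr ('d _ _ _); congr (_, _); rewrite /= ?addr0 ?add0r.
Qed.

Section LieGroup.
Variables (R : realType) (G : topGroupType) (n : nat) (LG : lie_group R G n).

Local Notation ch := (chart_at LG).

Local Hint Resolve ch_atlas ch_source : core.

Section Continuity.
Variables (c : chart R G n) (g : G).
Hypotheses (ac : atlas LG c) (sg : source c g).

Lemma near_target : \forall x \near c g, target c x.
Proof. by apply: open_nbhs_nbhs; split; [exact: open_target|exact: coord_target]. Qed.

(** The entries are derivatives of the multiplication in the direction of a basis vector of the
    second factor, continuous because the multiplication is smooth. *)
Lemma lmul_jac_continuous i j :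
  {for c g, continuous (fun x => lmul_jac LG c x i j)}.
Proof.
pose F := chart_mul c (ch 1%g) c.
pose v : 'rV[R]_n * 'rV[R]_n := (0, delta_mx 0 i).
have s1 k : source c k -> source c (k * 1)%g by rewrite mulg1.
have s1' := ch_source LG 1%g; have a1 := ch_atlas LG 1%g.
apply: (@near_eq_continuous _ _ (fun x => 'D_v F (x, ch 1%g 1%g) 0 j)).
  apply: filterS near_target => x tx.
  have sx := coord_inv_source tx; have e := coord_invK tx.
  have dF := differentiable_chart_mul ac a1 ac sx s1' (s1 _ sx).
  have [_ h] := jac_lmul ac a1 ac sx s1' (s1 _ sx).
  have {}h := h (delta_mx 0 i); rewrite e in h dF.
  rewrite (deriveE v dF).
  have mj := mul_jacobian (c \o (fun y : G => (coord_inv c x * y)%g) \o coord_inv (ch 1%g))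
    (ch 1%g 1%g) (delta_mx 0 i).
  apply: etrans (congr1 (fun w : 'rV[R]_n => w 0 j) (etrans (esym h) (esym mj))) _.
  by rewrite -rowE mxE.
have cD := derive_chart_mul_continuous (v := v) ac a1 ac sg s1' (s1 _ sg).
apply: (@continuous_comp _ _ _ (fun x => 'D_v F (x, ch 1%g 1%g)) (fun w : 'rV[R]_n => w 0 j)).
  apply: (@continuous_comp _ _ _ (fun x => (x, ch 1%g 1%g)) ('D_v F)) => //.
  exact: (@cvg_pair _ _ _ (nbhs (c g : 'rV[R]_n)) (nbhs (c g : 'rV[R]_n))
    (nbhs (ch 1%g 1%g : 'rV[R]_n)) _ _ _ id (cst (ch 1%g 1%g)) cvg_id (cvg_cst _)).
exact: coord_continuous.
Qed.

Lemma rmul_jac_continuous i j :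
  {for c g, continuous (fun x => rmul_jac LG c x i j)}.
Proof.
pose F := chart_mul (ch 1%g) c c.
pose v : 'rV[R]_n * 'rV[R]_n := (delta_mx 0 i, 0).
have s1 k : source c k -> source c (1 * k)%g by rewrite mul1g.
have s1' := ch_source LG 1%g; have a1 := ch_atlas LG 1%g.
apply: (@near_eq_continuous _ _ (fun x => 'D_v F (ch 1%g 1%g, x) 0 j)).
  apply: filterS near_target => x tx.
  have sx := coord_inv_source tx; have e := coord_invK tx.
  have dF := differentiable_chart_mul a1 ac ac s1' sx (s1 _ sx).
  have [_ h] := jac_rmul a1 ac ac s1' sx (s1 _ sx).
  have {}h := h (delta_mx 0 i); rewrite e in h dF.
  rewrite (deriveE v dF).
  have mj := mul_jacobian (c \o (fun y : G => (y * coord_inv c x)%g) \o coord_inv (ch 1%g))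
    (ch 1%g 1%g) (delta_mx 0 i).
  apply: etrans (congr1 (fun w : 'rV[R]_n => w 0 j) (etrans (esym h) (esym mj))) _.
  by rewrite -rowE mxE.
have cD := derive_chart_mul_continuous (v := v) a1 ac ac s1' sg (s1 _ sg).
apply: (@continuous_comp _ _ _ (fun x => 'D_v F (ch 1%g 1%g, x)) (fun w : 'rV[R]_n => w 0 j)).
  apply: (@continuous_comp _ _ _ (fun x => (ch 1%g 1%g, x)) ('D_v F)) => //.
  exact: (@cvg_pair _ _ _ (nbhs (c g : 'rV[R]_n)) (nbhs (ch 1%g 1%g : 'rV[R]_n))
    (nbhs (c g : 'rV[R]_n)) _ _ _ (cst (ch 1%g 1%g)) id (cvg_cst _) cvg_id).
exact: coord_continuous.
Qed.

End Continuity.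

(* The product rule applied to q h * h = h * g at h = 1. *)
Lemma jac_orbit_map (q : G -> G) g Q :
  is_jac (ch 1%g) (ch g) q 1%g Q -> {for 1%g, continuous q} -> q 1%g = g ->
  (forall h, q h * h = h * g)%g ->
  Q = right_translation_map LG g 1%g - left_translation_map LG g 1%g.
Proof.
move=> [dq qE] qc q1 qM.
have s01 : source (ch g) (g * 1)%g by rewrite mulg1.
have a0 := ch_atlas LG g; have a1 := ch_atlas LG 1%g.
have s0 := ch_source LG g; have s1 := ch_source LG 1%g.
pose F := chart_mul (ch g) (ch 1%g) (ch g).
have dF : differentiable F (ch g g, ch 1%g 1%g) := differentiable_chart_mul a0 a1 a0 s0 s1 s01.
pose qq : 'rV[R]_n -> 'rV[R]_n := ch g \o q \o coord_inv (ch 1%g).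
have qq1 : qq (ch 1%g 1%g) = ch g g by rewrite /qq /= coordK // q1.
have dF1 : differentiable F (qq (ch 1%g 1%g), ch 1%g 1%g) by rewrite qq1.
have [dd dE] := diff_diag dF1 dq.
have near_eq : \forall y \near ch 1%g 1%g,
    F (qq y, y) = (ch g \o (fun x : G => (x * g)%g) \o coord_inv (ch 1%g)) y.
  have cc : {for ch 1%g 1%g, continuous (q \o coord_inv (ch 1%g))}.
    apply: continuous_comp; first exact/coord_inv_continuous/coord_target.
    by rewrite coordK.
  have : \forall y \near ch 1%g 1%g, source (ch g) (q (coord_inv (ch 1%g) y)).
    apply: cc; rewrite /= coordK // q1.
    by apply: open_nbhs_nbhs; split => //; exact: open_source.
  by apply: filterS => y sy; rewrite /F /chart_mul /= /qq /= coordK // qM.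
have [rd rE] := near_eq_diff near_eq dd.
have fl : (fun b => F (ch g g, b)) =
    ch g \o (fun x : G => (g * x)%g) \o coord_inv (ch 1%g).
  by apply/funext => b; rewrite /F /chart_mul /= coordK.
(* The first partial derivative of [F] is taken with the second factor fixed at 1, so it is the
   identity. *)
have [_ idE] : is_jac (ch g) (ch g) (fun x : G => (x * 1)%g) g 1%:M.
  have -> : (fun x : G => (x * 1)%g) = id by apply/funext => x; rewrite mulg1.
  exact: is_jac_id.
have fr : (fun a => F (a, ch 1%g 1%g)) =
    ch g \o (fun x : G => (x * 1)%g) \o coord_inv (ch g).
  by apply/funext => b; rewrite /F /chart_mul /= coordK.
rewrite qq1 fl fr in dE.
have [_ leftE] := is_jac_left LG (mulg1 g).
have [_ rightE] := is_jac_right LG (mul1g g).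
suff e : right_translation_map LG g 1%g = Q + left_translation_map LG g 1%g.
  by rewrite e addrK.
apply: mulmx_rowI => u; rewrite mulmxDr.
have e1 := etrans (congr1 (mulmx u) (esym rightE)) (mul_jacobian _ _ u).
have e2 := etrans (congr1 (mulmx u) (esym leftE)) (mul_jacobian _ _ u).
have e3 := etrans (congr1 (mulmx u) (esym qE)) (mul_jacobian _ _ u).
have e4 := mul_jacobian (ch g \o (fun x : G => (x * 1)%g) \o coord_inv (ch g)) (ch g g) (u *m Q).
apply: etrans e1 (etrans (congr1 (fun h => h u) rE) (etrans (dE u) _)).
apply: esym.
have h4 : u *m Q = 'd (ch g \o (fun x : G => (x * 1)%g) \o coord_inv (ch g)) (ch g g) (u *m Q).
  by rewrite -[RHS]e4 idE mulmx1.
rewrite [X in _ + X]e2 [X in X + _]h4.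
by congr (_ + _); congr ('d _ _ _); exact: e3.
Qed.

End LieGroup.

(** * Conjugacy classes *)

Section LieGroup.
Variables (R : realType) (G : topGroupType) (n : nat) (LG : lie_group R G n).

Local Notation ch := (chart_at LG).
Local Notation lmap := (left_translation_map LG).
Local Notation rmap := (right_translation_map LG).

Lemma lmul_jac_chart_at g : lmul_jac LG (ch g) (ch g g) = lmap g 1%g.
Proof.
exact: (is_jac_unique (is_jac_lmul_jac (ch_atlas LG g) (ch_source LG g))
  (is_jac_left LG (mulg1 g))).
Qed.

Lemma rmul_jac_chart_at g : rmul_jac LG (ch g) (ch g g) = rmap g 1%g.
Proof.
exact: (is_jac_unique (is_jac_rmul_jac (ch_atlas LG g) (ch_source LG g))
  (is_jac_right LG (mul1g g))).
Qed.

Lemma coord_frame_chart_at g : coord_frame LG (ch g) (ch g g) = 1%:M.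
Proof.
exact: (is_jac_unique (is_jac_frame (ch_atlas LG g) (ch_source LG g))
  (is_jac_id (ch_source LG g))).
Qed.

Lemma left_translation_mapK g : lmap g 1%g *m lmap g^-1%g g = 1%:M.
Proof.
have := lmul_jacK (ch_atlas LG g) (ch_source LG g).
by rewrite lmul_jac_chart_at coord_frame_chart_at mul1mx.
Qed.

Lemma right_translation_map_unit g : rmap g 1%g \in unitmx.
Proof.
by have := rmul_jac_unit (ch_atlas LG g) (ch_source LG g); rewrite rmul_jac_chart_at.
Qed.

Lemma Ad_mul_Ad_inv g : Ad LG g *m Ad LG g^-1%g = 1%:M.
Proof. by rewrite -Ad_mul mulVg Ad_one. Qed.

(** At 1, the derivative of right translation by [g] is that of left translation composed with the
    adjoint action of the inverse. *)
Lemma thetaL_generating_field xi g :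
  thetaL LG g (generating_field LG xi g) = xi *m (1%:M - Ad LG g^-1%g).
Proof.
have alg (A Ai K K' L : 'M[R]_n) : A *m K' = K -> K *m L = 1%:M -> A *m Ai = 1%:M ->
    (xi *m K - xi *m K') *m L = xi *m (1%:M - Ai).
  move=> AK KL /mulmx1C AiA; rewrite -mulmxBr -mulmxA mulmxBl KL.
  have -> : K' *m L = Ai *m (A *m K' *m L) by rewrite !mulmxA AiA mul1mx.
  by rewrite AK KL mulmx1.
apply: alg (left_translation_mapK g) (Ad_mul_Ad_inv g).
exact: etrans (congr1 (mulmx (Ad LG g)) (esym (rmul_jac_chart_at g)))
  (etrans (Ad_rmul_jac (ch_atlas LG g) (ch_source LG g)) (lmul_jac_chart_at g)).
Qed.

Section ConjugacyClass.
Variables (C : topologicalType) (d : nat) (SC : manifold R C d) (iota : C -> G) (a : G).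
Hypothesis hC : is_conjugacy_class LG SC iota a.

(* If c = orb g0 then h |-> iota (orb (h g0)) is the map h |-> h g h^-1. *)
Lemma orbit_jac (c : C) : exists2 Q : 'M[R]_(n, d),
  Q *m tangent_map SC LG iota c = rmap (iota c) 1%g - lmap (iota c) 1%g & row_full Q.
Proof.
have [inj rng [si _] [orb [io so fo]]] := hC.
have [g0 cE] : exists g0, c = orb g0.
  have : range iota (iota c) by exists c.
  rewrite rng => -[g0 _ e]; exists g0; apply: inj.
  by rewrite io.
rewrite cE.
(* The derivative of h |-> orb (h g0) at 1; it is onto because right translation is invertible and
   [orb] is a submersion. *)
exists (rmap g0 1%g *m tangent_map LG SC orb g0); last first.
  have /row_fullP [B BE] := fo g0.
  apply/row_fullP; exists (B *m invmx (rmap g0 1%g)).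
  by rewrite -mulmxA (mulmxA (invmx _)) mulVmx ?mul1mx // right_translation_map_unit.
rewrite -mulmxA.
apply: (@jac_orbit_map _ _ _ LG (fun h => iota (orb (h * g0)%g))).
- have jo := is_jac_tangent_map g0 so.
  have ji := is_jac_tangent_map (orb g0) si.
  have jio := is_jac_comp (fun z => erefl (iota (orb z))) (ch_source LG g0)
    (chart_at_source SC (orb g0)) (erefl _) (so.1 g0) jo ji.
  exact: (is_jac_comp (fun z => erefl (iota (orb (z * g0)%g))) (ch_source LG 1%g)
    (ch_source LG g0) (mul1g g0) (@rmul_continuous _ _ _ LG g0 1%g)
    (is_jac_right LG (mul1g g0)) jio).
- apply: (@continuous_comp _ _ _ (fun h : G => (h * g0)%g) (iota \o orb)).
    exact: (@rmul_continuous _ _ _ LG).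
  by apply: continuous_comp; [exact: so.1|exact: si.1].
- by rewrite mul1g.
- by move=> h; rewrite !io /conjugation invgM !mulgA mulgKV.
Qed.

Lemma generating_field_tangent (c : C) xi : exists u,
  u *m tangent_map SC LG iota c = generating_field LG xi (iota c).
Proof.
(* The orbit map differentiates to the right minus the left invariant field, hence the sign. *)
have [Q QE _] := orbit_jac c; exists (- (xi *m Q)).
by rewrite mulNmx -mulmxA QE mulmxBr opprB.
Qed.

Lemma tangent_generating_field (c : C) u : exists xi,
  u *m tangent_map SC LG iota c = generating_field LG xi (iota c).
Proof.
have [Q QE fQ] := orbit_jac c.
have /submxP [z uE] : (u <= Q)%MS by exact: submx_full.
exists (- z); rewrite uE -mulmxA QE /generating_field /left_field /right_field.
move: (lmap _ _) (rmap _ _) => K K'.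
by rewrite mulmxBr !mulNmx opprK addrC.
Qed.

End ConjugacyClass.
End LieGroup.

(** * Passage to the limit *)

Section MatrixContinuity.
Variables (R : realType) (T : topologicalType) (x : T).

Definition mx_continuous m n (F : T -> 'M[R]_(m, n)) : Prop :=
  forall i j, continuous_at x (fun y => F y i j).

Lemma continuous_sum (I : Type) (r : seq I) (P : pred I) (F : I -> T -> R) :
  (forall i, continuous_at x (F i)) ->
  continuous_at x (fun y => \sum_(i <- r | P i) F i y).
Proof.
move=> Fc; elim: r => [|i r IH].
  by under eq_fun do rewrite big_nil; exact: cst_continuous.
under eq_fun do rewrite big_cons; case: (P i) => //.
exact: (continuousD (Fc i) IH).
Qed.

Lemma continuous_prod (I : Type) (r : seq I) (P : pred I) (F : I -> T -> R) :
  (forall i, continuous_at x (F i)) ->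
  continuous_at x (fun y => \prod_(i <- r | P i) F i y).
Proof.
move=> Fc; elim: r => [|i r IH].
  by under eq_fun do rewrite big_nil; exact: cst_continuous.
under eq_fun do rewrite big_cons; case: (P i) => //.
exact: (continuousM (Fc i) IH).
Qed.

Lemma mx_continuous_cst m n (A : 'M[R]_(m, n)) : mx_continuous (fun=> A).
Proof. by move=> i j; exact: cst_continuous. Qed.

Lemma mx_continuousD m n (F H : T -> 'M[R]_(m, n)) :
  mx_continuous F -> mx_continuous H -> mx_continuous (fun y => F y + H y).
Proof.
move=> Fc Hc i j; under eq_fun do rewrite mxE.
exact: (continuousD (Fc i j) (Hc i j)).
Qed.

Lemma mx_continuousZ m n (f : T -> R) (F : T -> 'M[R]_(m, n)) :
  continuous_at x f -> mx_continuous F -> mx_continuous (fun y => f y *: F y).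
Proof.
move=> fc Fc i j; under eq_fun do rewrite mxE.
exact: (continuousM fc (Fc i j)).
Qed.

Lemma mx_continuousM m n p (F : T -> 'M[R]_(m, n)) (H : T -> 'M[R]_(n, p)) :
  mx_continuous F -> mx_continuous H -> mx_continuous (fun y => F y *m H y).
Proof.
move=> Fc Hc i j; under eq_fun do rewrite mxE.
by apply: continuous_sum => k; exact: (continuousM (Fc i k) (Hc k j)).
Qed.

Lemma mx_continuous_tr m n (F : T -> 'M[R]_(m, n)) :
  mx_continuous F -> mx_continuous (fun y => (F y)^T).
Proof. by move=> Fc i j; under eq_fun do rewrite mxE; exact: Fc. Qed.

Lemma mx_continuous_block m1 m2 n1 n2 (F : T -> 'M[R]_(m1, n1))
    (H : T -> 'M[R]_(m1, n2)) (K : T -> 'M[R]_(m2, n1)) (L : T -> 'M[R]_(m2, n2)) :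
  mx_continuous F -> mx_continuous H -> mx_continuous K -> mx_continuous L ->
  mx_continuous (fun y => block_mx (F y) (H y) (K y) (L y)).
Proof.
move=> Fc Hc Kc Lc i j.
rewrite -[i]splitK -[j]splitK.
case: (fintype.split i) => i'; case: (fintype.split j) => j' /=.
- by under eq_fun do rewrite block_mxEul; exact: Fc.
- by under eq_fun do rewrite block_mxEur; exact: Hc.
- by under eq_fun do rewrite block_mxEdl; exact: Kc.
- by under eq_fun do rewrite block_mxEdr; exact: Lc.
Qed.

Lemma continuous_det n (F : T -> 'M[R]_n) :
  mx_continuous F -> continuous_at x (fun y => \det (F y)).
Proof.
move=> Fc; apply: continuous_sum => s.
apply: (@continuousM _ _ (fun=> (-1) ^+ s) (fun y => \prod_i F y i (s i))).
  exact: cst_continuous.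
by apply: continuous_prod => i; exact: Fc.
Qed.

(** By Cramer's rule the entries of the inverse are cofactors divided by a nonvanishing
    determinant. *)
Lemma mx_continuous_inv n (F : T -> 'M[R]_n) :
  mx_continuous F -> (\forall y \near x, F y \in unitmx) ->
  mx_continuous (fun y => invmx (F y)).
Proof.
move=> Fc Fu i j.
apply: (@near_eq_continuous _ _ (fun y => ((\det (F y))^-1 *: \adj (F y)) i j)).
  by apply: filterS Fu => y uy; rewrite /invmx uy.
apply: mx_continuousZ => [|k l].
  apply: (@continuousV _ _ (fun y => \det (F y))).
    by have := nbhs_singleton Fu; rewrite unitmxE unitfE.
  exact: continuous_det.
under eq_fun do rewrite mxE /cofactor.
apply: (@continuousM _ _ (fun=> (-1) ^+ (l + k)) (fun y => \det (row' l (col' k (F y))))).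
  exact: cst_continuous.
apply: continuous_det => i' j'; under eq_fun do rewrite !mxE.
exact: Fc.
Qed.

End MatrixContinuity.

Lemma pullback_mul (R : realType) m n p (P : 'M[R]_(m, n)) (Q : 'M[R]_(n, p))
    (a : mform R p) : pullback P (pullback Q a) = pullback (P *m Q) a.
Proof.
apply/functional_extensionality_dep => k; apply/funext => v; rewrite /pullback.
by congr (a k _); apply/funext => i; rewrite mulmxA.
Qed.

Lemma pullback1 (R : realType) n (a : mform R n) : pullback 1%:M a = a.
Proof.
apply/functional_extensionality_dep => k; apply/funext => v; rewrite /pullback.
by congr (a k _); apply/funext => i; rewrite mulmx1.
Qed.

Section LieGroup.
Variables (R : realType) (G : topGroupType) (n : nat) (LG : lie_group R G n).
Variables (B : {symmetric 'rV[R]_n}) (hB : Ad_invariant LG B).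

Local Notation ch := (chart_at LG).

Lemma Ad_gram g : Ad LG g *m gram B *m (Ad LG g)^T = gram B.
Proof. by apply: gram_ortho => u v; exact: hB. Qed.

Lemma thetaL_form_anti D g X Y : thetaL_form LG B D g X Y = - thetaL_form LG B D g Y X.
Proof. by rewrite /thetaL_form opprB. Qed.

(** The chart [c] is independent of [g], so that both sides can later be compared as functions of
    coordinates. *)
Lemma sqr_wedge_regular d (om : 'rV[R]_d -> 'rV[R]_d -> R) (psi : G -> mform R n)
    (c : chart R G n) (g : G) (P : 'M[R]_(d, n)) :
  is_mform (mform2 om) -> is_psi LG B psi -> atlas LG c -> source c g ->
  Ad LG g + 1%:M \in unitmx ->
  wedge (mexp (mform2 om)) (pullback P (pullback (coord_frame LG c (c g)) (psi g)))
    (fun i : 'I_d => delta_mx 0 i) ^+ 2 =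
  2^-1 ^+ n * \det (schur_mx (gram B) (Ad LG g) (P *m invmx (lmul_jac LG c (c g)))
    (\matrix_(i, j) om (delta_mx 0 i) (delta_mx 0 j))).
Proof.
move=> omF [_ _ _ psiE] ac sg uA.
have [s [s2 psi_g]] := psiE g uA.
rewrite pullback_mul (sqr_wedge_mexp _ _ psi_g); last 2 first.
- exact: mform2_anti.
- by move=> x y; rewrite thetaL_form_anti mulrN.
rewrite s2 detZ det_schur_mx // -mulrA; congr (_ * (_ * \det _)).
(* Left trivialization in the chart [c] is the inverse of [lmul_jac]. *)
have FL : coord_frame LG c (c g) *m left_translation_map LG g^-1%g g =
    invmx (lmul_jac LG c (c g)).
  have KL := lmul_jacK ac sg; have [uK _] := mulmx1_unit KL.
  by rewrite -[LHS](mulKmx uK) KL mulmx1.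
set V := P *m invmx _.
have thE (x : 'rV_d) : thetaL LG g (x *m (P *m coord_frame LG c (c g))) = x *m V.
  by rewrite /thetaL -!mulmxA FL.
have skew := cayley_skew (Ad_gram g) uA (trmx_gram B).
apply/matrixP => i j.
rewrite mxE [RHS]mxE [X in _ = X + _]mxE [X in _ = _ + X]mxE /thetaL_form !thE; congr (_ + _).
set D := cayley _; pose S := V *m D *m gram B *m V^T.
have BE k l : B (delta_mx 0 k *m V *m D) (delta_mx 0 l *m V) = S k l.
  by rewrite gramE trmx_mul -[RHS]mx_entry /S !mulmxA.
(* Skewness makes the two terms of [thetaL_form] equal, so the factor 1/4 becomes the 1/2 of the
   Schur complement. *)
have ST : S^T = - S.
  have -> : S = V *m (D *m gram B) *m V^T by rewrite /S !mulmxA.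
  by rewrite trmx_mul trmxK trmx_mul skew mulNmx mulmxN mulmxA.
have Sa : S j i = - S i j.
  by have /matrixP /(_ i j) := ST; rewrite mxE => ->; rewrite mxE.
by rewrite !BE Sa -/S; field.
Qed.

Section ConjugacyClass.
Variables (C : topologicalType) (d : nat) (SC : manifold R C d) (iota : C -> G) (a : G).
Hypothesis hC : is_conjugacy_class LG SC iota a.
Variable omega : C -> 'rV[R]_d -> 'rV[R]_d -> R.
Hypothesis homega : is_GHJW_form LG SC iota B omega.
Hypothesis hB0 : nondegenerate B.

(** Tangent vectors to the class are exactly the values of generating fields, so in left
    trivialization they form the image of 1 - Ad of the inverse, as [det_schur_mx_neq0] requires. *)
Lemma det_schur_class_neq0 (c : C) :
  \det (schur_mx (gram B) (Ad LG (iota c))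
    (tangent_map SC LG iota c *m invmx (left_translation_map LG (iota c) 1%g))
    (\matrix_(i, j) omega c (delta_mx 0 i) (delta_mx 0 j))) != 0.
Proof.
have [[omF _] _ omE] := homega.
have KL := left_translation_mapK LG (iota c); have [uK uL] := mulmx1_unit KL.
have LE : invmx (left_translation_map LG (iota c) 1%g) =
    left_translation_map LG (iota c)^-1%g (iota c).
  by rewrite -[RHS](mulKmx uK) KL mulmx1.
have tgE u xi : u *m tangent_map SC LG iota c = generating_field LG xi (iota c) ->
    u *m (tangent_map SC LG iota c *m invmx (left_translation_map LG (iota c) 1%g)) =
    xi *m (1%:M - Ad LG (iota c)^-1%g).
  by rewrite LE mulmxA => ->; exact: thetaL_generating_field.
have tgI u xi :
    u *m (tangent_map SC LG iota c *m invmx (left_translation_map LG (iota c) 1%g)) =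
    xi *m (1%:M - Ad LG (iota c)^-1%g) ->
    u *m tangent_map SC LG iota c = generating_field LG xi (iota c).
  rewrite -(thetaL_generating_field LG xi (iota c)) LE mulmxA.
  by move/(congr1 (mulmx^~ (invmx (left_translation_map LG (iota c)^-1%g (iota c)))));
    rewrite /thetaL !mulmxK.
apply: (det_schur_mx_neq0 (Ad_gram (iota c)) (Ad_mul_Ad_inv LG (iota c))).
- by move=> w; exact: nondegenerate_gram.
- move=> u uV0; have [_ _ [_ rf] _] := hC; have /row_freeP [Z ZE] := rf c.
  have : u *m tangent_map SC LG iota c = 0.
    have := congr1 (mulmx^~ (left_translation_map LG (iota c) 1%g)) uV0.
    by rewrite mulmxA mulmxKV // mul0mx.
  by move/(congr1 (mulmx^~ Z)); rewrite -mulmxA ZE mulmx1 mul0mx.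
- by move=> xi; have [u uE] := generating_field_tangent hC c xi; exists u; exact: tgE.
- by move=> u; have [xi xiE] := tangent_generating_field hC c u; exists xi; exact: tgE.
- move=> u1 u2 xi1 xi2 /tgI e1 /tgI e2; apply/matrixP => i j; rewrite !ord1.
  by rewrite -mform2_mx // (omE _ _ _ _ _ e1 e2) gramE [RHS]mxE.
Qed.

End ConjugacyClass.

Section Limit.
Variable psi : G -> mform R n.
Hypothesis hpsi : is_psi LG B psi.
Hypothesis hG : simply_connected R G.
Variables (d : nat) (om : 'rV[R]_d -> 'rV[R]_d -> R) (P : 'M[R]_(d, n)) (g : G).
Hypothesis omF : is_mform (mform2 om).

(** The data [om] and [P] stay frozen while the base point moves in the whole group, so the
    approximating regular points need not lie on the class. *)
Lemma sqr_wedge_psi :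
  wedge (mexp (mform2 om)) (pullback P (psi g)) (fun i : 'I_d => delta_mx 0 i) ^+ 2 =
  2^-1 ^+ n * \det (schur_mx (gram B) (Ad LG g)
    (P *m invmx (left_translation_map LG g 1%g))
    (\matrix_(i, j) om (delta_mx 0 i) (delta_mx 0 j))).
Proof.
pose c0 := ch g; pose x0 := c0 g.
have a0 : atlas LG c0 := ch_atlas LG g; have s0 : source c0 g := ch_source LG g.
(* The coordinate expression of [Ad], by [Ad_rmul_jac]. *)
pose A x := lmul_jac LG c0 x *m invmx (rmul_jac LG c0 x).
pose f x := wedge (mexp (mform2 om))
  (pullback P (pullback (coord_frame LG c0 x) (psi (coord_inv c0 x))))
  (fun i : 'I_d => delta_mx 0 i).
pose N x := schur_mx (gram B) (A x) (P *m invmx (lmul_jac LG c0 x))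
  (\matrix_(i, j) om (delta_mx 0 i) (delta_mx 0 j)).
have lu k : source c0 k -> lmul_jac LG c0 (c0 k) \in unitmx.
  by move=> sk; have [] := mulmx1_unit (lmul_jacK a0 sk).
have AE k : source c0 k -> A (c0 k) = Ad LG k.
  by move=> sk; rewrite /A -(Ad_rmul_jac a0 sk) mulmxK // rmul_jac_unit.
have near_t : \forall x \near x0, target c0 x := near_target s0.
(* In the expansion over shuffles only the factor from [psi] varies with [x], and it is continuous
   by smoothness of [psi]. *)
pose E : mform R d := mexp (mform2 om).
pose K (S : {set 'I_d}) : R := (-1) ^+ shuffle_inv S *
  E #|S| (fun i => delta_mx 0 (enum_val i)).
pose Psi (S : {set 'I_d}) x : R := psi (coord_inv c0 x)
    (fun i : 'I_#|~: S| => delta_mx 0 (enum_val i) *m P *m coord_frame LG c0 x).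
have fE : f = fun x => \sum_(S : {set 'I_d}) K S * Psi S x by [].
have fc : continuous_at x0 f.
  rewrite fE; apply: continuous_sum => S.
  apply: (@continuousM _ _ (fun=> K S) (Psi S)); first exact: cst_continuous.
  have [[_ sm] _ _ _] := hpsi.
  by apply: (sm #|~: S| c0 a0 _ 0%N); exact: coord_target.
have lc : mx_continuous x0 (lmul_jac LG c0) by move=> i j; exact: lmul_jac_continuous.
have rc : mx_continuous x0 (rmul_jac LG c0) by move=> i j; exact: rmul_jac_continuous.
have lic : mx_continuous x0 (fun x => invmx (lmul_jac LG c0 x)).
  apply: mx_continuous_inv lc _.
  apply: filterS near_t => x tx.
  by rewrite -(coord_invK tx) lu //; exact: coord_inv_source.
have ric : mx_continuous x0 (fun x => invmx (rmul_jac LG c0 x)).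
  apply: mx_continuous_inv rc _.
  apply: filterS near_t => x tx.
  by rewrite -(coord_invK tx) rmul_jac_unit //; exact: coord_inv_source.
have Ac : mx_continuous x0 A by exact: mx_continuousM.
have Vc : mx_continuous x0 (fun x => P *m invmx (lmul_jac LG c0 x)).
  by apply: mx_continuousM => //; exact: mx_continuous_cst.
have Nc : mx_continuous x0 N.
  apply: mx_continuous_block.
  - by apply: mx_continuousD => //; exact: mx_continuous_cst.
  - apply: mx_continuousZ; first exact: cst_continuous.
    apply: mx_continuousM; first exact: mx_continuous_cst.
    exact: mx_continuous_tr.
  - apply: mx_continuousM => //.
    apply: (@mx_continuousD _ _ _ _ _ (fun=> 1%:M) (fun x => - A x)).
      exact: mx_continuous_cst.
    move=> i j; under eq_fun do rewrite mxE.
    exact: (continuousN (Ac i j)).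
  - exact: mx_continuous_cst.
pose h x := f x ^+ 2 - 2^-1 ^+ n * \det (N x).
have hc : continuous_at x0 h.
  apply: (@continuousB _ _ _ (fun x => f x ^+ 2) (fun x => 2^-1 ^+ n * \det (N x))).
    exact: (continuousM fc fc).
  apply: (@continuousM _ _ (fun=> 2^-1 ^+ n) (fun x => \det (N x))).
    exact: cst_continuous.
  exact: continuous_det.
suff h0 : h x0 = 0.
  have e1 : lmul_jac LG c0 x0 = left_translation_map LG g 1%g := lmul_jac_chart_at LG g.
  have e2 : coord_frame LG c0 x0 = 1%:M := coord_frame_chart_at LG g.
  have e3 : coord_inv c0 x0 = g := coordK s0.
  have e4 : A x0 = Ad LG g := AE g s0.
  move/eqP: h0; rewrite subr_eq0 => /eqP.
  by rewrite /f /N e1 e2 e3 e4 pullback1.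
(* If the identity failed at [g], it would fail nearby, and by the regular case [Ad + 1] would be
   singular on a neighbourhood, against [det_add1_near]. *)
apply/eqP; apply: contrapT => /negP hN.
have near_h : \forall x \near x0, h x != 0.
  have nz : nbhs (h x0) [set r : R | r != 0].
    by apply: open_nbhs_nbhs; split; [exact: open_neq|exact: hN].
  exact: (hc _ nz).
apply: (@det_add1_near R G (lie_mul_continuous LG) (lie_inv_smooth LG).1 hG n
  (Ad LG) g (Ad_mul LG) (Ad_one LG)).
have near_s : \forall k \near g, source c0 k.
  by apply: open_nbhs_nbhs; split => //; exact: open_source.
have near_hk : \forall k \near g, h (c0 k) != 0 by exact: (Defs.coord_continuous s0 near_h).
near=> k.
have sk : source c0 k by near: k.
have hk : h (c0 k) != 0 by near: k.
apply/eqP; apply: contraNT hk; rewrite -unitfE => uk.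
rewrite /h subr_eq0; apply/eqP.
rewrite /f coordK // (sqr_wedge_regular P omF hpsi a0 sk); last by rewrite unitmxE.
by rewrite /N AE.
Unshelve. all: by end_near. Qed.

End Limit.
End LieGroup.

Theorem theorem2p5 (R : realType) (G : topGroupType) (n : nat)
    (LG : lie_group R G n)
    (hG : simply_connected R G)
    (mu : G -> {symmetric 'rV[R]_n}) (hmu : bi_invariant_metric LG mu)
    (B : {symmetric 'rV[R]_n}) (hB : Ad_invariant LG B)
    (hB0 : nondegenerate B) (hmuB : metric_of_form LG mu B)
    (psi : G -> mform R n) (hpsi : is_psi LG B psi)
    (a : G) (C : topologicalType) (d : nat) (SC : manifold R C d)
    (iota : C -> G) (hC : is_conjugacy_class LG SC iota a)
    (omega : C -> 'rV[R]_d -> 'rV[R]_d -> R)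
    (homega : is_GHJW_form LG SC iota B omega) :
  top_degree_volume_form (fun c : C =>
    wedge (mexp (mform2 (omega c)))
          (pullback (tangent_map SC LG iota c) (psi (iota c)))).
Proof.
move=> c; exists (fun i => delta_mx 0 i).
have [[omF _] _ _] := homega.
rewrite -sqrf_eq0 (sqr_wedge_psi hB hpsi hG _ _ (omF c)) mulf_neq0 //.
exact: (det_schur_class_neq0 hB hC homega hB0 c).
Qed.
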